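(* Let $X \sim \mathrm{N}_{n,p}(M,I_n,I_p)$. The matrix quadratic risk of an estimator $\hat{M}=X+g(X)$ with a weakly differentiable function $g:\mathbb{R}^{n\times p}\to\mathbb{R}^{n\times p}$ is given by $$R(M,\hat{M}) = n I_p + \mathrm{E}_M\left[\widetilde{\mathrm{div}}\, g(X) + (\widetilde{\mathrm{div}}\, g(X))^{\top} + g(X)^{\top} g(X)\right].$$
   Context: Let $n,p\ge 1$ be integers with $n-p-1>0$. $X\sim \mathrm{N}_{n,p}(M,I_n,I_p)$ means that $X\in\mathbb{R}^{n\times p}$ has independent entries $X_{ai}\sim \mathrm{N}(M_{ai},1)$, where $M\in\mathbb{R}^{n\times p}$ is an unknown mean matrix and $I_n$ is the $n$-dimensional identity matrix; $\mathrm{E}_M$ is expectation under this law, taken entrywise for matrices. The matrix quadratic loss is $L(M,\hat M)=(\hat M-M)^\top(\hat M-M)\in\mathbb{R}^{p\times p}$, and the matrix quadratic risk of an estimator $\hat M=\hat M(X)$ is $R(M,\hat M)=\mathrm{E}_M[L(M,\hat M(X))]$. A locally integrable function $h$ on $\mathbb{R}^{n\times p}$ is weakly differentiable if there are locally integrable functions $\partial_{ai}h$ ($a=1,\dots,n$, $i=1,\dots,p$) such that $\int h(X)\frac{\partial}{\partial X_{ai}}\phi(X)\,dX=-\int \partial_{ai}h(X)\,\phi(X)\,dX$ for every infinitely differentiable function $\phi:\mathbb{R}^{n\times p}\to\mathbb{R}$ with compact support; for a matrix-valued function this is understood entrywise. The matrix divergence of $g:\mathbb{R}^{n\times p}\to\mathbb{R}^{n\times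 p}$ is the function $\widetilde{\mathrm{div}}\, g:\mathbb{R}^{n\times p}\to\mathbb{R}^{p\times p}$ with entries $(\widetilde{\mathrm{div}}\, g(X))_{ij}=\sum_{a=1}^n\frac{\partial}{\partial X_{ai}}g_{aj}(X)$, where the derivatives of a weakly differentiable $g$ are its weak derivatives.
   Formalization: The formal theorem additionally assumes that every entry of div g(X) + (div g(X))^T + g(X)^T g(X) is integrable, i.e. that the expectation on the right-hand side exists; for a general weakly differentiable g it need not. *)

(* Defs.v *)
From HB Require Import structures.
From mathcomp Require Import all_boot all_order all_algebra.
From mathcomp Require Import all_classical all_reals all_analysis.

Set Implicit Arguments.
Unset Strict Implicit.
Unset Printing Implicit Defensive.

Import Order.TTheory GRing.Theory Num.Theory.
Import numFieldNormedType.Exports.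

Local Open Scope classical_set_scope.
Local Open Scope ring_scope.

Definition mx_display : measure_display.
Proof. exact: default_measure_display. Qed.

(* The sigma-algebra generated by the entries; since R is second countable,
   this is the Borel sigma-algebra of R^(m x n). *)
Section measurable_matrix.
Variables (R : realType) (m n : nat).

Definition mx_cylinders : set (set 'M[R]_(m, n)) :=
  [set C | exists i j (A : set R), measurable A /\
    C = [set X : 'M[R]_(m, n) | A (X i j)]].

HB.instance Definition _ := @isMeasurable.Build mx_display
  'M[R]_(m, n) <<s mx_cylinders >> (@sigma_algebra0 _ setT mx_cylinders)
  (@sigma_algebraC _ mx_cylinders) (@sigma_algebra_bigcup _ setT mx_cylinders).

Lemma measurable_mx_fun d (T : measurableType d) (f : T -> 'M[R]_(m, n)) :
  (forall i j, measurable_fun setT (fun x => f x i j)) ->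
  measurable_fun setT f.
Proof.
move=> mf; apply: (@measurability _ _ _ _ _ _ mx_cylinders) => //.
move=> _ [_ [i [j [A [mA ->]]]] <-].
exact: (mf i j measurableT A mA).
Qed.

End measurable_matrix.

(* Lebesgue measure on R^k, as the k-fold product of Lebesgue measure on R. *)
Section tuple_lebesgue.
Variable R : realType.

Definition tuple_cons k (x : measurableTypeR R * k.-tuple R) : k.+1.-tuple R :=
  [tuple of x.1 :: x.2].

Lemma measurable_tuple_cons k : measurable_fun setT (@tuple_cons k).
Proof. exact: measurable_cons. Qed.

Section step.
Local Open Scope ereal_scope.
Variables (k : nat) (mu : {sigma_finite_measure set (k.-tuple R) -> \bar R}).

Definition tuple_lebesgue_step : set (k.+1.-tuple R) -> \bar R :=
  pushforward (@lebesgue_measure R \x mu) (@tuple_cons k).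

Let step0 : tuple_lebesgue_step set0 = 0.
Proof. by rewrite /tuple_lebesgue_step /pushforward preimage_set0 measure0. Qed.

Let step_ge0 A : 0 <= tuple_lebesgue_step A.
Proof. by rewrite /tuple_lebesgue_step /pushforward measure_ge0. Qed.

Let step_sigma_additive : semi_sigma_additive tuple_lebesgue_step.
Proof.
by apply: measure_semi_sigma_additive; exact: measurable_tuple_cons.
Qed.

HB.instance Definition _ := isMeasure.Build _ _ _ tuple_lebesgue_step
  step0 step_ge0 step_sigma_additive.

Let tuple_uncons (t : k.+1.-tuple R) : measurableTypeR R * k.-tuple R :=
  (thead t, [tuple of behead t]).

Let step_sigma_finite : sigma_finite setT tuple_lebesgue_step.
Proof.
have munc : measurable_fun setT tuple_uncons.
  apply/measurable_fun_pairP; split.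
    exact: (@measurable_tnth _ R k.+1 ord0).
  exact: measurable_behead.
have /sigma_finiteP[F [TF ndF Foo]] := sigma_finiteT (@lebesgue_measure R).
have /sigma_finiteP[G [TG ndG Goo]] := sigma_finiteT mu.
exists (fun n => tuple_uncons @^-1` (F n `*` G n)).
  rewrite -preimage_bigcup (_ : \bigcup_n _ = setT) ?preimage_setT//.
  apply/seteqP; split=> // -[x y] _.
  have [k1 _ Fx] : (\bigcup_n F n) x by rewrite -TF.
  have [k2 _ Gy] : (\bigcup_n G n) y by rewrite -TG.
  exists (maxn k1 k2) => //; split.
    by move: x Fx; exact/subsetPset/ndF/leq_maxl.
  by move: y Gy; exact/subsetPset/ndG/leq_maxr.
move=> m; have [? ?] := Foo m; have [? ?] := Goo m; split.
  by rewrite -[X in measurable X]setTI; apply: munc => //; exact: measurableX.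
rewrite /tuple_lebesgue_step /pushforward -comp_preimage.
rewrite (_ : tuple_uncons \o _ = id); last first.
  by apply/funext => -[x t]; congr (_, _); apply/val_inj.
by rewrite product_measure1E// lte_mul_pinfty// ge0_fin_numE.
Qed.

HB.instance Definition _ := Measure_isSigmaFinite.Build _ _ _
  tuple_lebesgue_step step_sigma_finite.

End step.

Fixpoint tuple_lebesgue k : {sigma_finite_measure set (k.-tuple R) -> \bar R} :=
  if k is k'.+1 then tuple_lebesgue_step (tuple_lebesgue k')
  else \d_([tuple] : 0.-tuple R).

End tuple_lebesgue.

Section mx_lebesgue.
Local Open Scope ereal_scope.
Variables (R : realType) (n p : nat).

Definition mx_of_tuple (t : (n * p).-tuple R) : 'M[R]_(n, p) :=
  \matrix_(a, i) tnth t (mxvec_index a i).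

Lemma measurable_mx_of_tuple : measurable_fun setT mx_of_tuple.
Proof.
apply: measurable_mx_fun => a i.
rewrite (_ : (fun=> _) = (@tnth _ R)^~ (mxvec_index a i)).
  exact: measurable_tnth.
by apply/funext => t; rewrite mxE.
Qed.

Definition mx_lebesgue : set 'M[R]_(n, p) -> \bar R :=
  pushforward (tuple_lebesgue R (n * p)) mx_of_tuple.

Let mx_lebesgue0 : mx_lebesgue set0 = 0.
Proof. by rewrite /mx_lebesgue /pushforward preimage_set0 measure0. Qed.

Let mx_lebesgue_ge0 A : 0 <= mx_lebesgue A.
Proof. by rewrite /mx_lebesgue /pushforward measure_ge0. Qed.

Let mx_lebesgue_sigma_additive : semi_sigma_additive mx_lebesgue.
Proof.
by apply: measure_semi_sigma_additive; exact: measurable_mx_of_tuple.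
Qed.

HB.instance Definition _ := isMeasure.Build _ _ _ mx_lebesgue
  mx_lebesgue0 mx_lebesgue_ge0 mx_lebesgue_sigma_additive.

End mx_lebesgue.

Lemma measurable_tuple_box (R : realType) k (A : 'I_k -> set R) :
  (forall i, measurable (A i)) -> measurable [set t : k.-tuple R | forall i, A i (tnth t i)].
Proof.
move=> mA; rewrite (_ : [set t | _] = \bigcap_(i in [set: 'I_k]) ((@tnth k R)^~ i @^-1` A i)).
  apply: fin_bigcap_measurable => // i _; rewrite -[X in measurable X]setTI.
  exact: measurable_tnth.
by apply/seteqP; split => t /= h => [i _|i]; exact: h.
Qed.

Lemma tuple_lebesgue_box (R : realType) k (A : 'I_k -> set R) :
  (forall i, measurable (A i)) ->
  tuple_lebesgue R k [set t | forall i, A i (tnth t i)] =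
  (\prod_(i < k) lebesgue_measure (A i))%E.
Proof.
elim: k A => [|k IH] A mA.
  by rewrite big_ord0 /= diracE mem_set// => -[].
rewrite big_ord_recl -IH; last by move=> i; exact: mA.
rewrite /= /tuple_lebesgue_step /pushforward.
rewrite -product_measure1E//; last first.
  by apply: (@measurable_tuple_box _ _ (fun i => A (lift ord0 i))) => i; exact: mA.
  exact: mA.
congr (product_measure1 _ _ _); apply/seteqP; split=> -[x t] /=.
  move=> h; split; first exact: (h ord0).
  by move=> i; have := h (lift ord0 i); rewrite tnthS.
by move=> [hx ht] i; case: (unliftP ord0 i) => [j|] ->; rewrite ?tnthS//; exact: ht.
Qed.

Lemma mx_lebesgue_box (R : realType) n p (A : 'I_n -> 'I_p -> set R) :
  (forall a i, measurable (A a i)) ->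
  mx_lebesgue [set X : 'M[R]_(n, p) | forall a i, A a i (X a i)] =
  (\prod_(a < n) \prod_(i < p) lebesgue_measure (A a i))%E.
Proof.
move=> mA; pose B k := (enum_val (cast_ord (esym (mxvec_cast n p)) k)).
pose A' k := A (B k).1 (B k).2.
have BE a i : B (mxvec_index a i) = (a, i).
  by rewrite /B /mxvec_index cast_ordK enum_rankK.
rewrite pair_bigA /= (reindex B)/=; last first.
  exists (fun ai => mxvec_index ai.1 ai.2) => [k _|[a i] _]; last exact: BE.
  by case/mxvec_indexP: k => a i; rewrite BE.
rewrite -(@tuple_lebesgue_box R (n * p) A'); last by move=> k; exact: mA.
rewrite /mx_lebesgue /pushforward; congr (tuple_lebesgue _ _ _).
apply/seteqP; split=> t /= h.
  by move=> k; case/mxvec_indexP: k => a i; rewrite /A' BE; have := h a i; rewrite mxE.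
by move=> a i; have := h (mxvec_index a i); rewrite /A' BE mxE.
Qed.

Section weak_derivative.
Variables (R : realType) (n p : nat).
Local Notation E := 'M[R]_(n, p).
Local Notation mu := (@mx_lebesgue R n p).
Implicit Types (a : 'I_n) (i : 'I_p) (h dh phi : E -> R).

Definition mx_partial a i h : E -> R := fun X => 'D_(delta_mx a i) h X.

Definition mx_partials (s : seq ('I_n * 'I_p)) h : E -> R :=
  foldr (fun ai => mx_partial ai.1 ai.2) h s.

(* All iterated partial derivatives exist and are continuous. *)
Definition mx_smooth h := forall s,
  continuous (mx_partials s h) /\
  forall a i X, derivable (mx_partials s h) X (delta_mx a i).

Definition mx_compact_support h := compact (closure [set X | h X != 0]).

Definition mx_locally_integrable h :=
  measurable_fun setT h /\
  forall K : set E, compact K -> mu.-integrable K (EFin \o h).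

(* dh is a version of the weak partial derivative of h in the entry (a, i);
   versions differ only on Lebesgue-null sets. *)
Definition is_weak_partial a i h dh :=
  mx_locally_integrable dh /\
  forall phi, mx_smooth phi -> mx_compact_support phi ->
    (\int[mu]_X (h X * mx_partial a i phi X)%:E =
     - \int[mu]_X (dh X * phi X)%:E)%E.

Definition weakly_differentiable h :=
  mx_locally_integrable h /\ forall a i, exists dh, is_weak_partial a i h dh.

(* dg a i X is the matrix of the derivatives at X of the entries of g
   with respect to X_ai. *)
Definition is_weak_derivative (g : E -> E) (dg : 'I_n -> 'I_p -> E -> E) :=
  forall a i b j, is_weak_partial a i (fun X => g X b j) (fun X => dg a i X b j).

Definition mx_div (dg : 'I_n -> 'I_p -> E -> E) (X : E) : 'M[R]_p :=
  \matrix_(i, j) \sum_(a < n) dg a i X a j.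

End weak_derivative.

Section matrix_risk.
Context {R : realType} {n p : nat}.
Context {d : measure_display} {Omega : measurableType d}.
Variables (P : probability Omega R) (X : Omega -> 'M[R]_(n, p)).

(* X has independent entries X_ai ~ N(M_ai, 1). *)
Definition matrix_normal (M : 'M[R]_(n, p)) :=
  [/\ measurable_fun setT X,
      forall a i (A : set R), measurable A ->
        P [set w | A (X w a i)] = normal_prob (M a i) 1 A &
      forall A : 'I_n -> 'I_p -> set R, (forall a i, measurable (A a i)) ->
        P [set w | forall a i, A a i (X w a i)] =
        (\prod_(a < n) \prod_(i < p) P [set w | A a i (X w a i)])%E].

(* Entrywise expectation, with values in the extended reals. *)
Definition mx_expectation {q r : nat} (Y : Omega -> 'M[R]_(q, r)) :
    'M[\bar R]_(q, r) :=
  \matrix_(i, j) 'E_P[fun w => Y w i j]%E.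

Definition quadratic_loss (M Mhat : 'M[R]_(n, p)) : 'M[R]_p :=
  (Mhat - M)^T *m (Mhat - M).

Definition quadratic_risk (M : 'M[R]_(n, p))
    (Mhat : 'M[R]_(n, p) -> 'M[R]_(n, p)) : 'M[\bar R]_p :=
  mx_expectation (fun w => quadratic_loss M (Mhat (X w))).

End matrix_risk.

(* Main.v *)
Require Import Defs.
From HB Require Import structures.
From mathcomp Require Import all_boot all_order all_algebra.
From mathcomp Require Import all_classical all_reals all_analysis.
From mathcomp Require Import measurable_realfun ring lra.

(** Multiplying the weak derivative identity by the Gaussian density times a
    compactly supported smooth cutoff [w_k ^ 2] with [w_k -> 1] gives Stein's
    identity up to an error term in which one factor [w_k] survives, with
    [|d(w_k ^ 2)| <= eps_k w_k].  On the diagonal [i = j] the cross terms are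
    absorbed by AM-GM into [|g_j|^2 w_k ^ 2], so the integrability of
    [2 div g_j + |g_j|^2] alone bounds [E (|g_j|^2 w_k ^ 2)] uniformly and Fatou's
    lemma yields [g \in L^2].  Everything is then dominated, and the cutoff is
    removed by dominated convergence for every pair [(i, j)].  The cutoffs and the
    Gaussian density are products of one-variable functions of the entries, which
    reduces smoothness and the identification of the law of [X] to one variable. *)

Set Implicit Arguments.
Unset Strict Implicit.
Unset Printing Implicit Defensive.

Import Order.TTheory GRing.Theory Num.Theory.
Import numFieldNormedType.Exports.

Local Open Scope classical_set_scope.
Local Open Scope ring_scope.

(** * Smooth functions of one variable *)

Section smooth_functions.
Variable R : realType.
Implicit Types f g : R -> R.

(** The obstacle is that the hypothesis controls only the symmetrised sum div g + (div g)^T + g^T g: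
    neither g nor div g is assumed integrable for the Gaussian law on its own, so Stein's identity
    cannot be invoked entry by entry. The diagonal opens the way because there g^T g is a sum of
    squares, while Stein's identity trades the divergence for terms of first order in g, which a
    square dominates. Off the diagonal this yields integrability of the sum of the (i, j) and (j, i)
    divergences, but of neither one alone; hence the limit is taken in the sum of the two Stein
    identities.

    The cutoff is squared because d(w^2) = 2 w dw: the error is then linear in the product g w,
    which is what |g|^2 w^2 controls. Absorbing a fraction of the integral of |g|^2 w^2 into itself
    requires that integral to be finite beforehand. Local integrability of g does not give this; it
    comes from writing |g|^2 w^2 as the hypothesis times w^2 minus a locally integrable divergence
    times w^2. *)

Fixpoint derivable_upto n f : Prop :=
  if n is m.+1 then (forall x, derivable f x 1) /\ derivable_upto m (derive1 f)
  else True.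

Definition smooth f := forall n, derivable_upto n f.

Lemma derivable_uptoS n f : derivable_upto n.+1 f -> derivable_upto n f.
Proof.
elim: n f => [//|n IH] f /= [df [ddf h]]; split => //.
exact: IH.
Qed.

Lemma derivable_upto_is_derive n f f' : (forall x : R, is_derive x 1 f (f' x)) ->
  derivable_upto n f' -> derivable_upto n.+1 f.
Proof.
move=> df h; split; first by move=> x; exact: ex_derive.
suff -> : derive1 f = f' by [].
by apply/funext => x; rewrite derive1E derive_val.
Qed.

Lemma derivable_upto_cst n (c : R) : derivable_upto n (cst c).
Proof.
elim: n c => [//|n IH] c.
by apply: (derivable_upto_is_derive _ (IH 0)) => x; exact: is_derive_cst.
Qed.

Lemma derivable_uptoD n f g :
  derivable_upto n f -> derivable_upto n g -> derivable_upto n (fun x => f x + g x).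
Proof.
elim: n f g => [//|n IH] f g [df ddf] [dg ddg].
apply: (derivable_upto_is_derive _ (IH _ _ ddf ddg)) => x.
by rewrite !derive1E; apply: is_deriveD; exact: derivableP.
Qed.

(** The derivative of a product contains undifferentiated factors, so regularity is counted by
    order: [derivable_uptoS] lowers the order of these factors to meet the induction hypothesis. *)
Lemma derivable_uptoM n f g :
  derivable_upto n f -> derivable_upto n g -> derivable_upto n (fun x => f x * g x).
Proof.
elim: n f g => [//|n IH] f g hf hg.
have [df ddf] := hf; have [dg ddg] := hg.
apply: (@derivable_upto_is_derive n _ (fun x => f x * derive1 g x + g x * derive1 f x)) => [x|].
  by rewrite !derive1E; apply: is_deriveM; exact: derivableP.
apply: derivable_uptoD; apply: IH => //; exact: derivable_uptoS.
Qed.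

Lemma derivable_upto_affine n f (a b : R) :
  derivable_upto n f -> derivable_upto n (fun x => f (a * x + b)).
Proof.
elim: n f => [//|n IH] f [df ddf].
apply: (@derivable_upto_is_derive n _ (fun x => derive1 f (a * x + b) * a)) => [x|].
  rewrite derive1E; apply: (is_derive1_comp (f := f)); first exact: derivableP.
  by apply: is_derive_eq; rewrite addr0; exact: mulr1.
apply: derivable_uptoM; [exact: IH|exact: derivable_upto_cst].
Qed.

Lemma is_derive_normal_pdf (m x : R) :
  is_derive x 1 (normal_pdf m 1) (- (x - m) * normal_pdf m 1 x).
Proof.
rewrite normal_pdfE ?oner_eq0//; apply: is_derive_eq.
by rewrite /normal_fun /GRing.scale/= expr1n; field.
Qed.

Lemma derivable_upto_id n : derivable_upto n id.
Proof.
case: n => [//|n].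
apply: (@derivable_upto_is_derive n _ (cst 1)).
exact: derivable_upto_cst.
Qed.

(** The derivative is an affine function times the density itself, so the induction on the order
    closes up. *)
Lemma derivable_upto_normal_pdf n (m : R) : derivable_upto n (normal_pdf m 1).
Proof.
elim: n => [//|n IH].
apply: (@derivable_upto_is_derive n _ (fun x => (-1 * x + m) * normal_pdf m 1 x)) => [x|].
  by apply: is_derive_eq (is_derive_normal_pdf m x) _; ring.
apply: derivable_uptoM => //.
exact: (@derivable_upto_affine n id (-1) m (derivable_upto_id n)).
Qed.

Lemma smoothM f g : smooth f -> smooth g -> smooth (fun x => f x * g x).
Proof. by move=> hf hg n; exact: derivable_uptoM. Qed.

Lemma smooth_derivable f x : smooth f -> derivable f x 1.
Proof. by move=> /(_ 1%N)[]. Qed.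

Lemma smooth_derive1 f : smooth f -> smooth (derive1 f).
Proof. by move=> sf n; have [] := sf n.+1. Qed.

Lemma smooth_continuous f : smooth f -> continuous f.
Proof.
by move=> sf x; apply/differentiable_continuous/derivable1_diffP; exact: smooth_derivable.
Qed.

End smooth_functions.

(** * A smooth bump and bounds on it and its derivative *)

Section bump_function.
Variable R : realType.

Lemma expr_expRN_le (t : R) k : 0 <= t -> t ^+ k * expR (- t) <= k`!%:R.
Proof.
move=> t0; rewrite expRN ler_pdivrMr ?expR_gt0// mulrC.
rewrite -ler_pdivrMr ?ltr0n ?fact_gt0//.
case: k => [|k]; first by rewrite expr0 fact0 divr1 -expR0 ler_expR.
by apply: le_trans (expR_ge1Dxn k t0); rewrite lerDr.
Qed.

Lemma horner_expRN_bounded (q : {poly R}) :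
  exists C, forall t, 0 <= t -> `|q.[t] * expR (- t)| <= C.
Proof.
exists (\sum_(i < size q) `|q`_i| * i`!%:R) => t t0.
rewrite horner_coef mulr_suml; apply: le_trans (ler_norm_sum _ _ _) _.
apply: ler_sum => i _; rewrite -mulrA normrM ler_wpM2l//.
by rewrite ger0_norm ?expr_expRN_le// mulr_ge0 ?exprn_ge0 ?expR_ge0.
Qed.

(* With [q = 1] this is the usual smooth function that is flat at [0]; letting
   [q] vary makes the family stable under derivation. *)
Definition flat (q : {poly R}) (x : R) : R :=
  if 0 < x then q.[x^-1] * expR (- x^-1) else 0.

(** With t = 1/x, dividing by [x ^+ 2] turns [flat q x] into the polynomial 'X^2 * q at t times
    exp(-t), which is bounded for t >= 0. Quadratic order at the origin is what makes the derivative
    there vanish. *)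
Lemma flat_sqr_bound (q : {poly R}) : exists C, forall x, `|flat q x| <= C * x ^+ 2.
Proof.
have [C hC] := horner_expRN_bounded ('X^2 * q); exists C => x.
have C0 : 0 <= C by apply: le_trans (hC 0 (lexx _)); exact: normr_ge0.
rewrite /flat; case: ifPn => x0; last by rewrite normr0 mulr_ge0 ?sqr_ge0.
have xV0 : 0 <= x^-1 by rewrite invr_ge0 ltW.
have := hC _ xV0; rewrite hornerM hornerXn -mulrA normrM ger0_norm ?exprn_ge0//.
by rewrite exprVn ler_pdivrMl ?exprn_gt0// [leRHS]mulrC.
Qed.

(** For x > 0 the chain rule gives x^-2 (q - q')(1/x) exp(-1/x), again a member of the family.
    Smoothness then follows by induction on the order with [q] general. *)
Lemma is_derive_flat (q : {poly R}) (x : R) :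
  is_derive x 1 (flat q) (flat ('X^2 * (q - q^`())) x).
Proof.
have [x0|x0|->] := ltgtP x 0.
- rewrite [X in is_derive _ _ _ X]/flat ltNge (ltW x0)/=.
  apply: (near_eq_is_derive (f := cst 0)).
  near=> y; rewrite /flat ltNge ltW//=.
  near: y; exact: lt_nbhsl.
- rewrite [X in is_derive _ _ _ X]/flat x0.
  apply: (near_eq_is_derive (f := fun y : R => q.[y^-1] * expR (- y^-1))).
    near=> y; rewrite /flat ifT//.
    near: y; exact: lt_nbhsr.
  have xn0 : x != 0 by rewrite gt_eqF.
  have dV : is_derive x 1 (fun y : R => y^-1) (- x ^- 2).
    by apply: is_derive_eq; [exact: (is_deriveV xn0)|exact: mulr1].
  have dq : is_derive x 1 (fun y : R => q.[y^-1]) (q^`().[x^-1] * - x ^- 2).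
    exact: (is_derive1_comp (f := horner q)).
  have dN : is_derive x 1 (fun y : R => - y^-1) (x ^- 2).
    by apply: is_derive_eq; exact: opprK.
  have de : is_derive x 1 (fun y : R => expR (- y^-1)) (expR (- x^-1) * x ^- 2).
    exact: (is_derive1_comp (f := expR)).
  apply: is_derive_eq; rewrite /GRing.scale/= hornerM hornerXn hornerD hornerN.
  by rewrite exprVn; ring.
(* At the origin the quadratic bound makes the difference quotient at most C |h| in absolute
   value. *)
- rewrite [X in is_derive _ _ _ X]/flat ltxx.
  have [C hC] := flat_sqr_bound q.
  have f0 : flat q 0 = 0 by rewrite /flat ltxx.
  suff h : (fun h => h^-1 *: ((flat q \o shift 0) (h *: (1 : R)) - flat q 0)) @ 0^' --> (0 : R).
    by apply: DeriveDef; [apply/cvg_ex; exists 0|exact/cvg_lim].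
  have Ch0 : C * `|h| @[h --> (0:R)^'] --> (0 : R).
    apply: cvg_within_filter.
    suff : C * `|h| @[h --> (0 : R)] --> C * `|0 : R| by rewrite normr0 mulr0.
    by apply: cvgM; [exact: cvg_cst|exact: norm_continuous].
  apply: (@squeeze_cvgr _ _ _ _ (fun h => - (C * `|h|)) (fun h => C * `|h|)).
  + near=> h; have hn0 : h != 0 by near: h; exact: nbhs_dnbhs_neq.
    rewrite -ler_norml f0 subr0 /= addr0 /GRing.scale/= mulr1 normrM normfV.
    rewrite ler_pdivrMl ?normr_gt0//; apply: le_trans (hC h) _.
    by rewrite [leRHS]mulrCA -expr2 real_normK ?num_real.
  + by have := cvgN Ch0; rewrite oppr0; exact.
  + exact: Ch0.
Unshelve. all: by end_near. Qed.

Lemma smooth_flat (q : {poly R}) : smooth (flat q).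
Proof.
move=> n; elim: n q => [//|n IH] q.
exact: (derivable_upto_is_derive (is_derive_flat q) (IH _)).
Qed.

Lemma smooth_cst (c : R) : smooth (cst c).
Proof. by move=> n; exact: derivable_upto_cst. Qed.

Lemma smooth_affine (f : R -> R) (a b : R) : smooth f -> smooth (fun x => f (a * x + b)).
Proof. by move=> sf n; exact: derivable_upto_affine. Qed.

(** On (-1, 1) this is exp(2 - 2 / (1 - x^2)), and it vanishes elsewhere; the factor [expR 2]
    normalises the value at 0 to 1. The arguments are written as [a * x + b] to match
    [smooth_affine]. *)
Definition bump (x : R) : R :=
  expR 2 * (flat 1 (1 * x + 1) * flat 1 (-1 * x + 1)).

Lemma smooth_bump : smooth bump.
Proof.
apply: smoothM; first exact: smooth_cst.
by apply: smoothM; apply: smooth_affine; exact: smooth_flat.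
Qed.

Lemma flat_ge0 (x : R) : 0 <= flat 1 x.
Proof. by rewrite /flat; case: ifP => // _; rewrite hornerC mul1r expR_ge0. Qed.

Lemma bump_ge0 x : 0 <= bump x.
Proof. by rewrite /bump !mulr_ge0 ?expR_ge0 ?flat_ge0. Qed.

Lemma bump_eq0 x : 1 <= `|x| -> bump x = 0.
Proof.
rewrite /bump /flat ler_normr => /orP[] x1.
  by rewrite [X in _ * (_ * X)]ifF ?mulr0//; apply/negbTE; rewrite -leNgt; lra.
by rewrite [X in _ * (X * _)]ifF ?(mul0r,mulr0)//; apply/negbTE; rewrite -leNgt; lra.
Qed.

Lemma bump_le1 x : bump x <= 1.
Proof.
have [x1|x1] := leP 1 `|x|; first by rewrite bump_eq0.
move: x1; rewrite ltr_norml => /andP[x1 x2].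
have a0 : 0 < 1 * x + 1 by lra.
have b0 : 0 < -1 * x + 1 by lra.
rewrite /bump /flat a0 b0 !hornerC !mul1r -!expRD -[leRHS]expR0 ler_expR.
suff : 2 <= (x + 1)^-1 + (-1 * x + 1)^-1 by lra.
have -> : (x + 1)^-1 + (-1 * x + 1)^-1 = 2 / (1 - x ^+ 2).
  by field; apply/and3P; split; apply: lt0r_neq0; nra.
rewrite ler_pdivlMr; first by nra.
nra.
Qed.

Lemma bump0 : bump 0 = 1.
Proof.
rewrite /bump /flat !mulr0 !add0r ltr01 hornerC invr1 !mul1r -!expRD.
by rewrite (_ : _ + _ = 0) ?expR0//; lra.
Qed.

(** The derivative is continuous, so it attains a maximum in absolute value on [-1, 1]; outside,
    [bump] is locally constant. *)
Lemma derive1_bump_bounded : exists C, forall x, `|derive1 bump x| <= C.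
Proof.
have cb : continuous (fun x => `|derive1 bump x|).
  move=> x; apply: continuous_comp; last exact: norm_continuous.
  exact/smooth_continuous/smooth_derive1/smooth_bump.
have N11 : (-1 : R) <= 1 by lra.
have [c _ hc] := EVT_max N11 (continuous_subspaceT cb).
exists (`|derive1 bump c|) => x.
have [x1|x1] := leP `|x| 1; first by apply: hc; rewrite in_itv/= -ler_norml.
rewrite derive1E (near_eq_derive (g := cst 0)) ?derive_cst ?normr0//.
near=> y; rewrite bump_eq0// ltW//.
near: y; apply: (cvgr_gt _ (@norm_continuous _ R x)); exact: x1.
Unshelve. all: by end_near. Qed.

End bump_function.

(** * Domination and limit theorems for real-valued integrands *)

Section integrals.
Context {d : measure_display} {T : measurableType d} {R : realType}.
Variable mu : {measure set T -> \bar R}.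
Local Notation int f := (mu.-integrable setT (EFin \o f)).
Implicit Types f g : T -> R.

Lemma integrableD_EFin f g : int f -> int g -> int (fun x => f x + g x).
Proof. by move=> hf hg; exact: (integrableD measurableT hf hg). Qed.

Lemma integrableB_EFin f g : int f -> int g -> int (fun x => f x - g x).
Proof. by move=> hf hg; exact: (integrableB measurableT hf hg). Qed.

Lemma integrableZl_EFin (c : R) f : int f -> int (fun x => c * f x).
Proof. by move=> hf; exact: (integrableZl measurableT c hf). Qed.

Lemma integrable_measurable f : int f -> measurable_fun setT f.
Proof. by move=> /measurable_int /measurable_EFinP. Qed.

Lemma le_integrable_EFin f g : measurable_fun setT f ->
  (forall x, `|f x| <= g x) -> int g -> int f.
Proof.
move=> mf fg; apply: le_integrable => //; first exact/measurable_EFinP.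
by move=> x _; rewrite /= lee_fin (le_trans (fg x))// ler_norm.
Qed.

Lemma integrableM_sqr f g : measurable_fun setT f -> measurable_fun setT g ->
  int (fun x => f x ^+ 2) -> int (fun x => g x ^+ 2) -> int (fun x => f x * g x).
Proof.
move=> mf mg hf hg; apply: le_integrable_EFin (integrableD_EFin hf hg).
  exact: measurable_funM.
move=> x; rewrite normrM -[f x ^+ 2]real_normK ?num_real// -[g x ^+ 2]real_normK ?num_real//.
by have := normr_ge0 (f x); have := normr_ge0 (g x); nra.
Qed.

Lemma integrable_sum_EFin (I : Type) (s : seq I) (f : I -> T -> R) :
  (forall i, int (f i)) -> int (fun x => \sum_(i <- s) f i x).
Proof.
move=> hf; have := integrable_sum (mu := mu) (P := xpredT) measurableT s (fun i _ => hf i).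
by apply: (eq_integrable measurableT) => x _; rewrite sumEFin.
Qed.

Lemma Rintegral_sum (I : Type) (s : seq I) (f : I -> T -> R) :
  (forall i, int (f i)) ->
  \int[mu]_x (\sum_(i <- s) f i x) = \sum_(i <- s) \int[mu]_x f i x.
Proof.
move=> hf; elim: s => [|i s IH].
  under eq_Rintegral do rewrite big_nil.
  by rewrite big_nil Rintegral_cst// mul0r.
under eq_Rintegral do rewrite big_cons.
by rewrite RintegralD// ?IH ?big_cons//; exact: integrable_sum_EFin.
Qed.

(** Fatou's lemma. It serves where only the integrals are bounded and no integrable majorant is
    available yet. *)
Lemma integrable_of_bounded_integrals (q : T -> R) (f : nat -> T -> R) (B : R) :
  (forall k x, 0 <= f k x) -> (forall k, int (f k)) -> (forall k, \int[mu]_x f k x <= B) ->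
  (forall x, f k x @[k --> \oo] --> q x) -> int q.
Proof.
move=> f0 intf fB fq.
have q0 x : 0 <= q x.
  rewrite -(cvg_lim _ (fq x))//; apply: limr_ge; first by apply/cvg_ex; exists (q x).
  exact: nearW.
have fqE x : (f k x)%:E @[k --> \oo] --> (q x)%:E.
  by apply: cvg_EFin; [exact: nearW|exact: fq].
have mf k : measurable_fun setT (EFin \o f k) by exact: measurable_int (intf k).
have mq : measurable_fun setT (EFin \o q).
  by apply: (emeasurable_fun_cvg (fun k => EFin \o f k)) => // x _; exact: fqE.
apply/integrableP; split=> //; apply: (@le_lt_trans _ _ B%:E); last exact: ltry.
have := fatou mu measurableT mf (fun k x _ => f0 k x : (0 <= (f k x)%:E)%E).
rewrite (eq_integral (fun x => `|(q x)%:E|%E)); last first.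
  by move=> x _; rewrite (cvg_limn_einf_sup (fqE x)) gee0_abs// lee_fin.
move/le_trans; apply; rewrite limn_einf_lim; apply: lime_le; first exact: is_cvg_einfs.
apply: nearW => k; apply: (@le_trans _ _ (\int[mu]_x (f k x)%:E)%E).
  by apply: ereal_inf_lbound; exists k => //=.
by rewrite -[leLHS]fineK ?lee_fin; [exact: fB|exact: (integrable_fin_num measurableT (intf k))].
Qed.

Lemma integral_cvg_zero (q F : T -> R) (f : nat -> T -> R) :
  (forall k, int (f k)) -> (forall k, \int[mu]_x f k x = 0) ->
  int F -> (forall k x, `|f k x| <= F x) ->
  (forall x, f k x @[k --> \oo] --> q x) -> (\int[mu]_x (q x)%:E = 0)%E.
Proof.
move=> intf f0 intF fF fq.
have fqE x : (f k x)%:E @[k --> \oo] --> (q x)%:E.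
  by apply: cvg_EFin; [exact: nearW|exact: fq].
have mf k : measurable_fun setT (EFin \o f k) by exact: measurable_int (intf k).
have mq : measurable_fun setT (EFin \o q).
  by apply: (emeasurable_fun_cvg (fun k => EFin \o f k)) => // x _; exact: fqE.
have [_ _] := @dominated_convergence _ _ _ mu _ measurableT (fun k => EFin \o f k)
  (EFin \o q) (EFin \o F) mf mq (aeW _ (fun x _ => fqE x)) intF
  (aeW _ (fun x k _ => fF k x : (`|(f k x)%:E| <= (F x)%:E)%E)).
rewrite (_ : (fun k => _) = cst 0%E); last first.
  apply/funext => k; rewrite /= -[LHS]fineK; last exact: (integrable_fin_num measurableT (intf k)).
  by congr EFin; exact: f0.
by move=> h; apply: cvg_unique h _ => //; exact: cvg_cst.
Qed.

End integrals.

(** * Products of functions of the entries *)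

Section entrywise_products.
Variables (R : realType) (n p : nat).
Implicit Types (F : 'I_n * 'I_p -> R -> R) (Y : 'M[R]_(n, p)).

Definition mx_prod F Y : R := \prod_c F c (Y c.1 c.2).

Definition update F c g : 'I_n * 'I_p -> R -> R := fun c' => if c' == c then g else F c'.

Lemma mx_prod_update F c g Y :
  mx_prod (update F c g) Y = g (Y c.1 c.2) * \prod_(c' | c' != c) F c' (Y c'.1 c'.2).
Proof.
rewrite /mx_prod (bigD1 c)//= /update eqxx; congr (_ * _).
by apply: eq_bigr => c' /negbTE ->.
Qed.

Lemma mx_prodD1 F c Y :
  mx_prod F Y = F c (Y c.1 c.2) * \prod_(c' | c' != c) F c' (Y c'.1 c'.2).
Proof. by rewrite /mx_prod (bigD1 c). Qed.

Lemma mx_prodM F G Y : mx_prod (fun c x => F c x * G c x) Y = mx_prod F Y * mx_prod G Y.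
Proof. exact: big_split. Qed.

(** Moving along [delta_mx a i] changes one factor only, so the difference quotient of the product
    is that of [F (a, i)] times the constant [C]. *)
Lemma is_derive_mx_prod F Y a i : derivable (F (a, i)) (Y a i) 1 ->
  is_derive Y (delta_mx a i) (mx_prod F) (mx_prod (update F (a, i) (derive1 (F (a, i)))) Y).
Proof.
move=> df; pose C := \prod_(c' | c' != (a, i)) F c' (Y c'.1 c'.2).
have h : (fun h => h^-1 *: ((mx_prod F \o shift Y) (h *: delta_mx a i) - mx_prod F Y)) @ 0^'
    --> mx_prod (update F (a, i) (derive1 (F (a, i)))) Y.
  rewrite mx_prod_update -/C derive1E.
  rewrite (_ : (fun _ => _) = (fun h =>
    h^-1 *: ((F (a, i) \o shift (Y a i)) (h *: (1 : R)) - F (a, i) (Y a i)) * C)).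
    by apply: cvgM; [exact: df|exact: cvg_cst].
  apply/funext => h /=; rewrite !(mx_prodD1 _ (a, i)) -/C /=.
  rewrite (_ : \prod_(c' | c' != (a, i)) _ = C); last first.
    apply: eq_bigr => -[b j] /= bj; rewrite !mxE.
    rewrite (_ : _ && _ = false) ?mulr0 ?add0r//.
    by apply/negbTE; apply: contra bj => /andP[/eqP -> /eqP ->].
  by rewrite !mxE !eqxx -mulrBl scalerAl.
by apply: DeriveDef; [apply/cvg_ex; eexists; exact: h|exact/cvg_lim].
Qed.

Lemma mx_partial_mx_prod F a i : smooth (F (a, i)) ->
  mx_partial a i (mx_prod F) = mx_prod (update F (a, i) (derive1 (F (a, i)))).
Proof.
move=> sF; apply/funext => Y; apply: derive_val.
by apply: is_derive_mx_prod; exact: smooth_derivable.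
Qed.

Lemma continuous_mx_prod F : (forall c, continuous (F c)) -> continuous (mx_prod F).
Proof.
move=> cF; rewrite /mx_prod; elim: (index_enum _) => [|c r IH].
  by under eq_fun do rewrite big_nil; exact: cst_continuous.
under eq_fun do rewrite big_cons; move=> Y; apply: continuousM; last exact: IH.
apply: (@continuous_comp _ _ _ (fun Z : 'M[R]_(n, p) => Z c.1 c.2)); last exact: cF.
exact: coord_continuous.
Qed.

(** Products of smooth one-variable functions are stable under partial derivatives, so continuity
    and derivability need to be checked on such products only. *)
Lemma mx_partials_mx_prod F s : (forall c, smooth (F c)) ->
  exists2 G, forall c, smooth (G c) & mx_partials s (mx_prod F) = mx_prod G.
Proof.
move=> sF; elim: s => [|[a i] s [G sG /= ->]]; first by exists F.
exists (update G (a, i) (derive1 (G (a, i)))); last exact: mx_partial_mx_prod.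
by move=> c; rewrite /update; case: ifP => // _; exact: smooth_derive1.
Qed.

Lemma mx_smooth_mx_prod F : (forall c, smooth (F c)) -> mx_smooth (mx_prod F).
Proof.
move=> sF s; have [G sG ->] := mx_partials_mx_prod s sF; split.
  by apply: continuous_mx_prod => c; exact: smooth_continuous.
move=> a i Y; apply: ex_derive; apply: is_derive_mx_prod; exact: smooth_derivable.
Qed.

Definition mx_box (r : R) : set 'M[R]_(n, p) := [set Y | forall a i, `|Y a i| <= r].

Lemma continuous_vec_mx : continuous (@vec_mx R n p).
Proof.
move=> v A [P /= nP PA].
exists (fun _ k => [set x | forall a i, k = mxvec_index a i -> P a i x]) => [j k|w hw].
  case/mxvec_indexP: k => a i; have := nP a i; rewrite mxE -(ord1 j).
  apply: filterS => x Px b l /cast_ord_inj/enum_rank_inj [<- <-]; exact: Px.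
by apply: PA => a i; rewrite mxE; exact: (hw ord0).
Qed.

(** Compactness of boxes is available for row vectors through [rV_compact]; [vec_mx] transports it
    to matrices. *)
Lemma compact_mx_box r : compact (mx_box r).
Proof.
rewrite (_ : mx_box r = @vec_mx R n p @` [set v : 'rV[R]_(n * p) | forall k, `[- r, r]%classic (v ord0 k)]).
  apply: continuous_compact; first exact/continuous_subspaceT/continuous_vec_mx.
  by apply: (@rV_compact _ _ (fun=> `[- r, r]%classic)) => _; exact: segment_compact.
apply/seteqP; split => [Y hY|_ [v hv <-] a i] /=.
  exists (mxvec Y); last exact: mxvecK.
  by move=> k; case/mxvec_indexP: k => a i; rewrite mxvecE in_itv/= -ler_norml.
by rewrite mxE ler_norml; have := hv (mxvec_index a i); rewrite /= in_itv.
Qed.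

Lemma closed_mx_box r : closed (mx_box r).
Proof.
apply: compact_closed; last exact: compact_mx_box.
exact: (@norm_hausdorff R 'M[R]_(n, p)).
Qed.

Lemma mx_compact_support_mx_prod F r : (forall c x, r < `|x| -> F c x = 0) ->
  mx_compact_support (mx_prod F).
Proof.
move=> F0; apply: (@subclosed_compact _ _ (mx_box r)).
- exact: closed_closure.
- exact: compact_mx_box.
rewrite closureEbigcap => Y; apply; split; first exact: closed_mx_box.
move=> Z /= Z0 a i; rewrite leNgt; apply/negP => /F0 F0Z.
by move: Z0; rewrite (mx_prodD1 _ (a, i)) F0Z mul0r eqxx.
Qed.

Lemma measurable_mx_coord a i : measurable_fun setT (fun Y : 'M[R]_(n, p) => Y a i).
Proof.
move=> _ A mA; rewrite setTI; apply: sub_sigma_algebra.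
by exists a, i, A.
Qed.

Lemma measurable_mx_prod F : (forall c, measurable_fun setT (F c)) ->
  measurable_fun setT (mx_prod F).
Proof.
move=> mF; apply: measurable_prod => c _.
by apply: (measurableT_comp (mF c)); exact: measurable_mx_coord.
Qed.

Lemma measurable_mx_box r : measurable (mx_box r).
Proof.
rewrite (_ : mx_box r = \bigcap_(c in [set: 'I_n * 'I_p])
    ((fun Y : 'M[R]_(n, p) => Y c.1 c.2) @^-1` `[- r, r])); last first.
  apply/seteqP; split=> [Y hY [a i] _|Y hY a i] /=.
    by rewrite in_itv/= -ler_norml.
  by have := hY (a, i) I; rewrite /= in_itv/= -ler_norml.
apply: fin_bigcap_measurable => // -[a i] _.
by rewrite -[X in measurable X]setTI; exact: measurable_mx_coord.
Qed.

End entrywise_products.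

(** * The law of a Gaussian matrix *)

Section density.
Local Open Scope ereal_scope.
Context d (T : measurableType d) (R : realType).
Variables (mu nu : {measure set T -> \bar R}) (rho : T -> R).
Hypothesis mrho : measurable_fun setT rho.
Hypothesis rho0 : forall x, (0 <= rho x)%R.
Hypothesis nuE : forall A, measurable A -> nu A = \int[mu]_(x in A) (rho x)%:E.

Import HBNNSimple.

Let integral_density_nnsfun (h : {nnsfun T >-> R}) :
  \int[nu]_x (h x)%:E = \int[mu]_x ((h x)%:E * (rho x)%:E).
Proof.
have mhr r : measurable (h @^-1` [set r]) by [].
have mind r : measurable_fun setT (EFin \o (fun x => r * \1_(h @^-1` [set r]) x)%R).
  by apply/measurable_EFinP; apply: measurable_funM => //; exact: measurable_indic.
have mrhoE : measurable_fun setT (EFin \o rho) by exact/measurable_EFinP.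
transitivity (\sum_(r \in range h) \int[nu]_x (r * \1_(h @^-1` [set r]) x)%:E).
  under eq_integral do rewrite fimfunE -fsumEFin//.
  by rewrite ge0_integral_fsum// => r x _; rewrite EFinM nnfun_muleindic_ge0.
transitivity (\sum_(r \in range h)
    \int[mu]_x ((r * \1_(h @^-1` [set r]) x)%:E * (rho x)%:E)); last first.
  rewrite -ge0_integral_fsum//; last 2 first.
  - by move=> r; apply: emeasurable_funM; [exact: mind|exact: mrhoE].
  - by move=> r x _; rewrite EFinM mule_ge0 ?nnfun_muleindic_ge0 ?lee_fin.
  apply: eq_integral => x _; rewrite [X in _ = X%:E * _]fimfunE -fsumEFin//.
  by rewrite ge0_mule_fsuml// => r; rewrite EFinM nnfun_muleindic_ge0.
apply: eq_fsbigr => r; rewrite inE => -[t _ <-].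
rewrite integralZl_indic_nnsfun// integral_indic// setIT nuE//.
under [RHS]eq_integral do rewrite EFinM -muleA.
rewrite ge0_integralZl//; first last.
- by rewrite lee_fin.
- by move=> x _; rewrite mule_ge0 ?lee_fin.
- by apply: emeasurable_funM => //; exact/measurable_EFinP/measurable_indic.
congr (_ * _); rewrite integral_mkcond epatch_indic.
by apply: eq_integral => x _; rewrite muleC.
Qed.

Lemma ge0_integral_density (f : T -> \bar R) :
  (forall x, 0 <= f x) -> measurable_fun setT f ->
  \int[nu]_x f x = \int[mu]_x (f x * (rho x)%:E).
Proof.
move=> f0 mf; pose h := nnsfun_approx measurableT mf.
have mrhoE : measurable_fun setT (EFin \o rho) by exact/measurable_EFinP.
have hf x : (h n x)%:E @[n --> \oo] --> f x by exact: cvg_nnsfun_approx.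
have ndh x : {homo (fun n => h n x) : m n / (m <= n)%N >-> (m <= n)%R}.
  by move=> m n mn; exact/lefP/nd_nnsfun_approx.
transitivity (limn (fun n => \int[nu]_x (h n x)%:E)).
  rewrite -monotone_convergence//.
  - by apply: eq_integral => x _; apply/esym/cvg_lim => //; exact: hf.
  - by move=> n; exact/measurable_EFinP.
  - by move=> n x _; rewrite lee_fin.
  - by move=> x _ m n mn; rewrite lee_fin ndh.
transitivity (limn (fun n => \int[mu]_x ((h n x)%:E * (rho x)%:E))).
  by congr (limn _); apply/funext => n; exact: integral_density_nnsfun.
rewrite -monotone_convergence//.
- apply: eq_integral => x _; apply: cvg_lim => //.
  by apply: cvgeZr => //; exact: hf.
- by move=> n; apply: emeasurable_funM => //; exact/measurable_EFinP.
- by move=> n x _; rewrite mule_ge0 ?lee_fin.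
- by move=> x _ m n mn; rewrite lee_wpmul2r ?lee_fin ?ndh.
Qed.

(** Since [rho] is nonnegative, the positive and negative parts of the product are those of [f]
    times [rho]. The equality is one of extended reals and asks for no integrability of [f]. *)
Lemma integral_density (f : T -> R) : measurable_fun setT f ->
  \int[nu]_x (f x)%:E = \int[mu]_x (f x * rho x)%:E.
Proof.
move=> mf; have mfE : measurable_fun setT (EFin \o f) by exact/measurable_EFinP.
rewrite integralE [RHS]integralE; congr (_ - _).
- rewrite ge0_integral_density//; last exact: measurable_funepos.
  apply: eq_integral => x _.
  by rewrite !funeposE/= EFinM maxe_pMl ?lee_fin// mul0e.
- rewrite ge0_integral_density//; last exact: measurable_funeneg.
  apply: eq_integral => x _.
  by rewrite !funenegE/= maxe_pMl ?lee_fin// mul0e -EFinM mulNr.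
Qed.

End density.

Section product_integral.
Local Open Scope ereal_scope.
Variable R : realType.

(** Tonelli's theorem peels off one coordinate at a time. The induction starts from the Dirac mass
    at the empty tuple, whose total mass 1 is the empty product. *)
Lemma tuple_lebesgue_prod k (f : 'I_k -> R -> R) :
  (forall i, measurable_fun setT (f i)) -> (forall i x, (0 <= f i x)%R) ->
  \int[tuple_lebesgue R k]_t (\prod_(i < k) f i (tnth t i))%R%:E =
  \prod_(i < k) \int[lebesgue_measure]_x (f i x)%:E.
Proof.
elim: k f => [|k IH] f mf f0.
  rewrite big_ord0 /= (_ : (fun t => _) = cst 1%:E).
    by rewrite integral_cst//= diracE mem_set// mule1.
  by apply/funext => t; rewrite big_ord0.
have mfE i : measurable_fun setT (EFin \o f i) by exact/measurable_EFinP.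
have mprod j (g : 'I_j -> R -> R) : (forall i, measurable_fun setT (g i)) ->
    measurable_fun setT (EFin \o (fun t : j.-tuple R => \prod_(i < j) g i (tnth t i))%R).
  move=> mg; apply/measurable_EFinP; apply: measurable_prod => i _.
  by apply: (measurableT_comp (mg i)); exact: measurable_tnth.
rewrite big_ord_recl -IH//= /tuple_lebesgue_step ge0_integral_pushforward//; last 3 first.
- exact: measurable_tuple_cons.
- exact: mprod.
- by move=> t _; rewrite lee_fin prodr_ge0.
rewrite preimage_setT fubini_tonelli1/=; last 2 first.
- by apply: measurableT_comp; [exact: mprod|exact: measurable_tuple_cons].
- by move=> t; rewrite lee_fin prodr_ge0.
rewrite /fubini_F.
have prodE x (t : k.-tuple R) :
    (\prod_(i < k) f (lift ord0 i) (tnth (tuple_cons (x, t)) (lift ord0 i)))%R =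
    (\prod_(i < k) f (lift ord0 i) (tnth t i))%R.
  by apply: eq_bigr => i ?; rewrite tnthS.
transitivity (\int[lebesgue_measure]_x ((f ord0 x)%:E *
    \int[tuple_lebesgue R k]_t (\prod_(i < k) f (lift ord0 i) (tnth t i))%R%:E)).
  apply: eq_integral => x _; rewrite -ge0_integralZl//; last 3 first.
  - exact: (mprod k (fun i => f (lift ord0 i))).
  - by move=> t _; rewrite lee_fin prodr_ge0.
  - by rewrite lee_fin.
  by apply: eq_integral => t _ /=; rewrite big_ord_recl EFinM prodE.
rewrite ge0_integralZr//; [exact: mfE| |].
- by move=> x _; rewrite lee_fin.
- by apply: integral_ge0 => t _; rewrite lee_fin prodr_ge0.
Qed.

Lemma mx_lebesgue_prod n p (F : 'I_n * 'I_p -> R -> R) :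
  (forall c, measurable_fun setT (F c)) -> (forall c x, (0 <= F c x)%R) ->
  \int[@mx_lebesgue R n p]_Y (mx_prod F Y)%:E =
  \prod_c \int[lebesgue_measure]_x (F c x)%:E.
Proof.
(* [B] inverts [mxvec_index]: it sends a position in the flattened tuple back to its matrix
   entry. *)
move=> mF F0; pose B k := enum_val (cast_ord (esym (mxvec_cast n p)) k).
have BE a i : B (mxvec_index a i) = (a, i).
  by rewrite /B /mxvec_index cast_ordK enum_rankK.
have Bbij P : {on P, bijective B}.
  exists (fun ai => mxvec_index ai.1 ai.2) => [k _|[a i] _]; last exact: BE.
  by case/mxvec_indexP: k => a i; rewrite BE.
rewrite (reindex B)//= -tuple_lebesgue_prod//.
rewrite /mx_lebesgue ge0_integral_pushforward//; last 3 first.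
- exact: measurable_mx_of_tuple.
- by apply/measurable_EFinP; exact: measurable_mx_prod.
- by move=> Y _; rewrite lee_fin prodr_ge0.
rewrite preimage_setT; apply: eq_integral => t _ /=.
rewrite /mx_prod (reindex B)//=; congr _%:E; apply: eq_bigr => k _.
by case/mxvec_indexP: k => a i; rewrite BE mxE.
Qed.

End product_integral.

Section normal_law.
Context {R : realType} {n p : nat} {d : measure_display} {Omega : measurableType d}.
Variables (P : probability Omega R) (X : Omega -> 'M[R]_(n, p)) (M : 'M[R]_(n, p)).
Hypothesis hX : matrix_normal P X M.
Local Notation mu := (@mx_lebesgue R n p).

Definition normal_density : 'M[R]_(n, p) -> R :=
  mx_prod (fun c => normal_pdf (M c.1 c.2) 1).

Let rho := normal_density.

Lemma normal_density_ge0 Y : 0 <= rho Y.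
Proof. by apply: prodr_ge0 => c _; exact: normal_pdf_ge0. Qed.

Lemma measurable_normal_density : measurable_fun setT rho.
Proof. by apply: measurable_mx_prod => c; exact: measurable_normal_pdf. Qed.

(** Uniqueness of measures asks for a generating class closed under intersection. The cylinders that
    define the sigma-algebra constrain a single entry each, so rectangles replace them. *)
Definition mx_rectangles : set (set 'M[R]_(n, p)) :=
  [set C | exists2 A : 'I_n -> 'I_p -> set R, (forall a i, measurable (A a i)) &
    C = [set Y : 'M[R]_(n, p) | forall a i, A a i (Y a i)]].

Lemma measurable_mx_rectangles : mx_rectangles `<=` measurable.
Proof.
move=> _ [A mA ->].
rewrite (_ : [set Y : 'M[R]_(n, p) | _] = \bigcap_(c in [set: 'I_n * 'I_p])
    ((fun Y : 'M[R]_(n, p) => Y c.1 c.2) @^-1` A c.1 c.2)); last first.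
  by apply/seteqP; split=> [Y hY [a i] _|Y hY a i] /=; [exact: hY|exact: (hY (a, i))].
apply: fin_bigcap_measurable => // -[a i] _.
by rewrite -[X in measurable X]setTI; exact: measurable_mx_coord.
Qed.

Lemma measurable_mxE : @measurable _ 'M[R]_(n, p) = <<s mx_rectangles >>.
Proof.
apply/seteqP; split.
  change (<<s @mx_cylinders R n p >> `<=` <<s mx_rectangles >>).
  apply: smallest_sub; first exact: smallest_sigma_algebra.
  move=> _ [a [i [A [mA ->]]]]; apply: sub_sigma_algebra.
  exists (fun b j => if (b == a) && (j == i) then A else setT).
    by move=> b j; case: ifP.
  apply/seteqP; split=> Y /= hY; last by have := hY a i; rewrite !eqxx.
  by move=> b j; case: ifP => // /andP[/eqP -> /eqP ->].
by apply: smallest_sub; [exact: sigma_algebra_measurable|exact: measurable_mx_rectangles].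
Qed.

Lemma setI_closed_mx_rectangles : setI_closed mx_rectangles.
Proof.
move=> _ _ [A mA ->] [B mB ->]; exists (fun a i => A a i `&` B a i).
  by move=> a i; exact: measurableI.
apply/seteqP; split=> Y /=; first by move=> [hA hB] a i; split.
by move=> h; split=> a i; have [] := h a i.
Qed.

(** The indicator of a rectangle is the product of the indicators of its sides, so the density
    restricted to it is again a product of functions of the entries. *)
Lemma integral_normal_density_rectangle (A : 'I_n -> 'I_p -> set R) :
  (forall a i, measurable (A a i)) ->
  (\int[mu]_(Y in [set Y : 'M[R]_(n, p) | forall a i, A a i (Y a i)]) (rho Y)%:E =
   \prod_(a < n) \prod_(i < p) normal_prob (M a i) 1 (A a i))%E.
Proof.
move=> mA; rewrite pair_bigA/=.
pose F c x := normal_pdf (M c.1 c.2) 1 x * \1_(A c.1 c.2) x.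
transitivity (\int[mu]_Y (mx_prod F Y)%:E)%E.
  rewrite integral_mkcond; apply: eq_integral => Y _.
  rewrite /mx_prod /F big_split/= patchE; case: ifPn.
    rewrite inE /= => hY; congr _%:E; rewrite [X in _ = _ * X]big1 ?mulr1//.
    by move=> c _; rewrite indicE mem_set.
  rewrite notin_setE/= => /existsNP[a] /existsNP[i] hY.
  rewrite [X in (_ * X)%:E](bigD1 (a, i))//= indicE memNset//.
  by rewrite mul0r mulr0.
rewrite mx_lebesgue_prod.
- apply: eq_bigr => c _; rewrite /normal_prob [RHS]integral_mkcond.
  by apply: eq_integral => x _; rewrite epatch_indic/= -EFinM.
- move=> c; apply: measurable_funM; first exact: measurable_normal_pdf.
  exact: measurable_indic.
- by move=> c x; rewrite mulr_ge0 ?normal_pdf_ge0.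
Qed.

Lemma matrix_normal_law A : measurable A ->
  pushforward P X A = (\int[mu]_(Y in A) (rho Y)%:E)%E.
Proof.
have [mX XN XI] := hX.
pose nu A := (\int[mu]_(Y in A) (rho Y)%:E)%E.
have mrhoE : measurable_fun setT (EFin \o rho).
  by apply/measurable_EFinP; exact: measurable_normal_density.
have nu0 : nu set0 = 0%E by rewrite /nu integral_set0.
have nu_ge0 B : (0 <= nu B)%E.
  by apply: integral_ge0 => Y _; rewrite lee_fin normal_density_ge0.
have nuS : semi_sigma_additive nu.
  move=> F mF tF mUF; rewrite /nu ge0_integral_bigcup//; last 2 first.
  - exact: measurable_funTS.
  - by move=> Y _; rewrite lee_fin normal_density_ge0.
  by apply: is_cvg_ereal_nneg_natsum_cond => k _ _; exact: nu_ge0.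
pose nuM : {measure set 'M[R]_(n, p) -> \bar R} :=
  HB.pack nu (isMeasure.Build _ _ _ nu nu0 nu_ge0 nuS).
(* Two measures that agree on rectangles coincide. The constant sequence [setT] can serve as
   exhaustion because the law of [X] is finite. *)
move=> mA; apply: (@measure_unique _ _ _ mx_rectangles (fun=> setT)
   measurable_mxE setI_closed_mx_rectangles _ _ _ nuM) => //.
- by move=> _; exists (fun _ _ => setT) => //; apply/seteqP; split.
- by rewrite bigcup_const//; exists 0%N.
- move=> _ [B mB ->]; rewrite [RHS]integral_normal_density_rectangle//.
  rewrite /= /pushforward XI//; apply: eq_bigr => a _; apply: eq_bigr => i _.
  exact: XN.
- by move=> _; rewrite /= /pushforward preimage_setT probability_setT ltry.
Qed.

End normal_law.

(** * First and second moments of the normal density *)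

Section normal_moments.
Context {R : realType} (m : R).
Local Notation mu := (@lebesgue_measure R).
Local Notation pdf := (normal_pdf m 1).

Lemma integral_derivative (F f : R -> R) (a b : R) :
  (forall x : R, is_derive x 1 F (f x)) -> continuous f -> a < b ->
  (\int[mu]_(x in `[a, b]) (f x)%:E = (F b - F a)%:E)%E.
Proof.
move=> dF cf ab; have cF : continuous F.
  by move=> x; apply/differentiable_continuous/derivable1_diffP; exact: ex_derive.
rewrite (@continuous_FTC2 _ f F)//.
- exact: continuous_subspaceT.
- split; first by move=> x _; exact: ex_derive.
  + exact/cvg_at_right_filter/cF.
  + exact/cvg_at_left_filter/cF.
- by move=> x _; rewrite derive1E derive_val.
Qed.

Let cpdf : continuous pdf.
Proof. by apply: continuous_normal_pdf; exact: oner_neq0. Qed.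

Let cpdf1 : continuous (fun x => (x - m) * pdf x).
Proof.
by move=> x; apply: cvgM; [apply: cvgB; [exact: cvg_id|exact: cvg_cst]|exact: cpdf].
Qed.

Let cpdf2 : continuous (fun x => (x - m) ^+ 2 * pdf x).
Proof.
under eq_fun do rewrite expr2 -mulrA.
by move=> x; apply: cvgM; [apply: cvgB; [exact: cvg_id|exact: cvg_cst]|exact: cpdf1].
Qed.

Let I (k : nat) : set R := `[m - k.+1%:R, m + k.+1%:R]%classic.

Let I_bigcup : \bigcup_k I k = setT.
Proof.
apply/seteqP; split => // x _; exists (Num.truncn `|x - m|) => //.
rewrite /I /= in_itv/= -ler_distl; apply/ltW; exact: truncnS_gt.
Qed.

Let mI k : measurable (I k).
Proof. exact: measurable_itv. Qed.

Let I_nd : {homo I : a b / (a <= b)%N >-> (a <= b)%O}.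
Proof.
move=> a b ab; apply/subsetPset => x; rewrite /I /= !in_itv/= -!ler_distl => /le_trans; apply.
by rewrite ler_nat.
Qed.

(** This bounds the boundary terms of the integration by parts below. With r = k + 1, the inequality
    exp y >= 1 + y at y = r^2 / 2 gives r <= (2 / r) exp(r^2 / 2). *)
Let pdf_tail (k : nat) (x : R) : `|x - m| = k.+1%:R -> k.+1%:R * pdf x <= normal_peak 1 * 2 * k.+1%:R^-1.
Proof.
move=> xk; rewrite normal_pdfE ?oner_neq0// mulrCA -mulrA ler_wpM2l ?normal_peak_ge0//.
rewrite /normal_fun expr1n -[(x - m) ^+ 2]real_normK ?num_real// xk.
set r : R := k.+1%:R; have r0 : 0 < r by rewrite ltr0n.
rewrite mulNr expRN ler_pdivrMr ?expR_gt0//.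
have := expR_ge1Dx (r ^+ 2 / (1 *+ 2)).
rewrite -(ler_pM2l (_ : 0 < 2 / r)) ?divr_gt0//; apply: le_trans.
rewrite mulrDr mulr1 [X in _ <= _ + X](_ : _ = r); last by field; rewrite gt_eqF.
by rewrite lerDr divr_ge0// ltW.
Qed.

(** The function -(x - m) pdf has derivative ((x - m)^2 - 1) pdf. On the intervals [I k] the second
    moment therefore differs from the mass by the boundary term [e k], which tends to 0. *)
Lemma integral_sqr_normal_pdf : (\int[mu]_x ((x - m) ^+ 2 * pdf x)%:E = 1)%E.
Proof.
pose e k : R := - (k.+1%:R * pdf (m + k.+1%:R)) - (k.+1%:R * pdf (m - k.+1%:R)).
have e0 : e k @[k --> \oo] --> 0.
  apply: (@squeeze_cvgr _ _ _ _ (fun k => - (normal_peak 1 * 4 * harmonic k)) (fun k => 0)).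
  - near=> k; rewrite /e.
    have h1 := @pdf_tail k (m + k.+1%:R); have h2 := @pdf_tail k (m - k.+1%:R).
    have {}h1 := h1 _; have {}h2 := h2 _.
    have p1 := normal_pdf_ge0 m 1 (m + k.+1%:R); have p2 := normal_pdf_ge0 m 1 (m - k.+1%:R).
    have k0 : 0 <= k.+1%:R :> R by [].
    rewrite /harmonic/=.
    have {}h1 := h1 ltac:(by rewrite addrC addKr ger0_norm).
    have {}h2 := h2 ltac:(by rewrite addrC addKr normrN ger0_norm).
    have q1 := mulr_ge0 k0 p1; have q2 := mulr_ge0 k0 p2.
    move: (k.+1%:R : R) h1 h2 q1 q2 => r h1 h2 q1 q2.
    by apply/andP; split; lra.
  - rewrite -oppr0; apply: cvgN; rewrite -(mulr0 (normal_peak 1 * 4)).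
    by apply: cvgM; [exact: cvg_cst|exact: cvg_harmonic].
  - exact: cvg_cst.
have mE (f : R -> R) A : continuous f -> measurable_fun A (EFin \o f).
  move=> cf; apply/measurable_EFinP; apply: measurable_funTS.
  exact: continuous_measurable_fun.
have IE k : (\int[mu]_(x in I k) ((x - m) ^+ 2 * pdf x)%:E =
    \int[mu]_(x in I k) (pdf x)%:E + (e k)%:E)%E.
  have int f : continuous f -> mu.-integrable (I k) (EFin \o f).
    move=> cf; apply: continuous_compact_integrable; first exact: segment_compact.
    exact: continuous_subspaceT.
  have <- : (\int[mu]_(x in I k) ((x - m) ^+ 2 * pdf x - pdf x)%:E = (e k)%:E)%E.
    have dF (x : R) : is_derive x 1 (fun x => - (x - m) * pdf x) ((x - m) ^+ 2 * pdf x - pdf x).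
      have dp := is_derive_normal_pdf m x.
      by apply: is_derive_eq; rewrite /GRing.scale/=; ring.
    have cf : continuous (fun x => (x - m) ^+ 2 * pdf x - pdf x).
      by move=> x; apply: cvgB; [exact: cpdf2|exact: cpdf].
    rewrite (integral_derivative dF cf); last by rewrite ltrD2l gtrN// ltr0n.
    by congr EFin; rewrite /e; ring.
  rewrite -integralD_EFin; [|exact: mI| |]; last 2 first.
  - exact: int.
  - by apply: int => x; apply: cvgB; [exact: cpdf2|exact: cpdf].
  by apply: eq_integral => x _ /=; rewrite -EFinD; congr EFin; ring.
have cvgI (f : R -> R) : continuous f -> (forall x, 0 <= f x) ->
    (\int[mu]_(x in I k) (f x)%:E)%E @[k --> \oo] --> (\int[mu]_x (f x)%:E)%E.
  move=> cf f0; rewrite -I_bigcup; apply: ge0_nondecreasing_set_cvg_integral => //.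
  - by move=> k; exact: (mE f _ cf).
  - by move=> k x _; rewrite lee_fin.
have h2 := cvgI _ cpdf2 (fun x => mulr_ge0 (sqr_ge0 (x - m)) (normal_pdf_ge0 m 1 x)).
have h1 := cvgI _ cpdf (normal_pdf_ge0 m 1); rewrite integral_normal_pdf in h1.
rewrite (funext IE) in h2; apply: cvg_unique h2 _ => //.
have := @cvgeD _ _ _ _ _ (fun k => (e k)%:E) _ 0%E _ h1; rewrite adde0; apply => //.
by apply: cvg_EFin; [exact: nearW|exact: e0].
Unshelve. all: by end_near. Qed.

Lemma integrable_sqr_normal_pdf : mu.-integrable setT (fun x : R => ((x - m) ^+ 2 * pdf x)%:E).
Proof.
apply/integrableP; split; first by apply/measurable_EFinP; apply: continuous_measurable_fun; exact: cpdf2.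
suff -> : (\int[mu]_x `|((x - m) ^+ 2 * pdf x)%:E| = 1)%E by rewrite ltry.
rewrite -integral_sqr_normal_pdf; apply: eq_integral => x _.
by rewrite gee0_abs// lee_fin mulr_ge0 ?sqr_ge0 ?normal_pdf_ge0.
Qed.

(** The antiderivative -pdf takes equal values at the ends of the symmetric interval [I k], so each
    truncated integral is exactly 0. The inequality |x - m| <= (x - m)^2 + 1 supplies the
    majorant. *)
Lemma normal_pdf_first_moment : mu.-integrable setT (fun x : R => ((x - m) * pdf x)%:E) /\
  (\int[mu]_x ((x - m) * pdf x)%:E = 0)%E.
Proof.
pose f (x : R) := ((x - m) * pdf x)%:E.
have mf : measurable_fun setT f.
  by apply/measurable_EFinP; apply: continuous_measurable_fun; exact: cpdf1.
have int0 k : (\int[mu]_x (f \_ (I k)) x = 0)%E.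
  have dF (x : R) : is_derive x 1 (fun x => - pdf x) ((x - m) * pdf x).
    by have dp := is_derive_normal_pdf m x; apply: is_derive_eq; ring.
  rewrite -integral_mkcond (integral_derivative dF)//; last by rewrite ltrD2l gtrN// ltr0n.
  rewrite normal_pdfE ?oner_neq0// /normal_fun.
  by rewrite [m + _]addrC addrK [m - _]addrC addrK sqrrN subrr.
have := @dominated_convergence _ _ _ mu setT measurableT (fun k => f \_ (I k)) f
  (fun x : R => ((x - m) ^+ 2 * pdf x)%:E + (pdf x)%:E)%E.
case=> //.
- move=> k; apply/(measurable_restrict _ _ _); first exact: measurable_itv.
    by [].
  by apply: measurable_funTS; exact: mf.
- apply: aeW => x _; apply: cvg_near_cst.
  have : (\bigcup_k I k) x by rewrite I_bigcup.
  move=> [N _ IN]; near=> k; rewrite patchE mem_set//.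
  have /subsetPset : (I N <= I k)%O by apply: I_nd; near: k; exact: nbhs_infty_ge.
  exact.
- by apply: integrableD => //; [exact: integrable_sqr_normal_pdf|exact: integrable_normal_pdf].
- apply: aeW => x k _; rewrite patchE; case: ifP => _; last first.
    rewrite abse0 -EFinD lee_fin; apply: addr_ge0; last exact: normal_pdf_ge0.
    by apply: mulr_ge0; [exact: sqr_ge0|exact: normal_pdf_ge0].
  rewrite /f /= -EFinD lee_fin normrM [`|pdf x|]ger0_norm ?normal_pdf_ge0//.
  rewrite -[X in _ <= _ + X]mul1r -mulrDl ler_wpM2r ?normal_pdf_ge0//.
  rewrite -[X in _ <= X + 1]real_normK ?num_real//.
  by have := normr_ge0 (x - m); nra.
move=> intf _; under eq_fun do rewrite int0.
by move=> h; split => //; apply: cvg_unique h _ => //; exact: cvg_cst.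
Unshelve. all: by end_near. Qed.

End normal_moments.

(** * Expectations as integrals against the Gaussian density *)

Section normal_expectation.
Context {R : realType} {n p : nat} {d : measure_display} {Omega : measurableType d}.
Variables (P : probability Omega R) (X : Omega -> 'M[R]_(n, p)) (M : 'M[R]_(n, p)).
Hypothesis hX : matrix_normal P X M.
Local Notation mu := (@mx_lebesgue R n p).
Local Notation rho := (normal_density M).
Local Open Scope ereal_scope.

Let mX : measurable_fun setT X. Proof. by case: hX. Qed.

Lemma measurable_mx_comp (f : 'M[R]_(n, p) -> R) : measurable_fun setT f ->
  measurable_fun setT (fun w => f (X w)).
Proof. by move=> mf; apply: (measurableT_comp mf). Qed.

Lemma ge0_integral_matrix_normal (f : 'M[R]_(n, p) -> \bar R) :
  (forall Y, 0 <= f Y) -> measurable_fun setT f ->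
  \int[P]_w f (X w) = \int[mu]_Y (f Y * (rho Y)%:E).
Proof.
move=> f0 mf.
rewrite -(@ge0_integral_density _ _ _ mu (pushforward P X) rho)//.
- by rewrite ge0_integral_pushforward.
- exact: measurable_normal_density.
- exact: normal_density_ge0.
- by move=> A mA; exact: matrix_normal_law.
Qed.

Lemma integral_matrix_normal (f : 'M[R]_(n, p) -> R) : measurable_fun setT f ->
  \int[P]_w (f (X w))%:E = \int[mu]_Y (f Y * rho Y)%:E.
Proof.
move=> mf; have mfE : measurable_fun setT (EFin \o f) by exact/measurable_EFinP.
rewrite -(@integral_density _ _ _ mu (pushforward P X) rho)//; first last.
- by move=> A mA; exact: matrix_normal_law.
- exact: normal_density_ge0.
- exact: measurable_normal_density.
rewrite [LHS]integralE [RHS]integralE; congr (_ - _).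
- rewrite ge0_integral_pushforward//; last exact: measurable_funepos.
  by rewrite preimage_setT; apply: eq_integral => w _; rewrite /= !funeposE.
- rewrite ge0_integral_pushforward//; last exact: measurable_funeneg.
  by rewrite preimage_setT; apply: eq_integral => w _; rewrite /= !funenegE.
Qed.

Lemma integrable_matrix_normal (f : 'M[R]_(n, p) -> R) : measurable_fun setT f ->
  mu.-integrable setT (fun Y => (f Y * rho Y)%:E) ->
  P.-integrable setT (fun w => (f (X w))%:E).
Proof.
move=> mf /integrableP[_ foo]; apply/integrableP; split.
  by apply/measurable_EFinP; exact: measurable_mx_comp.
rewrite (ge0_integral_matrix_normal (f := fun Y => `|(f Y)%:E|))//; last first.
  by apply: measurableT_comp => //; exact/measurable_EFinP.
apply: le_lt_trans foo; apply: ge0_le_integral => //.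
- by move=> Y _; rewrite mule_ge0// lee_fin normal_density_ge0.
- apply: emeasurable_funM; last by apply/measurable_EFinP; exact: measurable_normal_density.
  by apply: measurableT_comp => //; exact/measurable_EFinP.
- apply: measurableT_comp => //; apply/measurable_EFinP.
  by apply: measurable_funM => //; exact: measurable_normal_density.
- by move=> Y _; rewrite EFinM abseM [`|(rho Y)%:E|]gee0_abs// lee_fin normal_density_ge0.
Qed.

Lemma integral_normal_prob (m : R) (f : R -> R) : measurable_fun setT f ->
  \int[normal_prob m 1]_x (f x)%:E = \int[lebesgue_measure]_x (f x * normal_pdf m 1 x)%:E.
Proof.
move=> mf; apply: integral_density => //.
- exact: measurable_normal_pdf.
- by move=> x; exact: normal_pdf_ge0.
Qed.

Let mXE a i : measurable_fun setT (fun w => X w a i).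
Proof. by apply: (measurable_mx_comp (f := fun Y => Y a i)); exact: measurable_mx_coord. Qed.

Lemma ge0_integral_normal_entry a i (f : R -> \bar R) :
  (forall x, 0 <= f x) -> measurable_fun setT f ->
  \int[P]_w f (X w a i) = \int[normal_prob (M a i) 1]_x f x.
Proof.
move=> f0 mf; have [_ XN _] := hX.
have mXE' : measurable_fun setT (fun w => X w a i : measurableTypeR R) by exact: mXE.
transitivity (\int[pushforward P (fun w => X w a i : measurableTypeR R)]_x f x).
  by rewrite ge0_integral_pushforward.
pose nu := measure_function_pushforward__canonical__measure_function_Measure P mXE'.
by apply: (@eq_measure_integral _ _ _ _ (normal_prob (M a i) 1) nu) => A mA _; exact: XN.
Qed.

Definition normal_noise a i w : R := (X w a i - M a i)%R.

Lemma measurable_normal_noise a i : measurable_fun setT (normal_noise a i).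
Proof. exact: measurable_funB. Qed.

Lemma integral_sqr_normal_noise a i : \int[P]_w ((normal_noise a i w) ^+ 2)%:E = 1.
Proof.
rewrite (@ge0_integral_normal_entry a i (fun x => ((x - M a i) ^+ 2)%:E)).
- rewrite integral_normal_prob ?integral_sqr_normal_pdf//.
  by apply: measurable_funX; exact: measurable_funB.
- by move=> x; rewrite lee_fin sqr_ge0.
- by apply/measurable_EFinP; apply: measurable_funX; exact: measurable_funB.
Qed.

Lemma integrable_sqr_normal_noise a i :
  P.-integrable setT (fun w => ((normal_noise a i w) ^+ 2)%:E).
Proof.
apply/integrableP; split.
  by apply/measurable_EFinP; apply: measurable_funX; exact: measurable_normal_noise.
suff -> : \int[P]_w `|((normal_noise a i w) ^+ 2)%:E| = 1 by rewrite ltry.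
rewrite -(integral_sqr_normal_noise a i); apply: eq_integral => w _.
by rewrite gee0_abs// lee_fin sqr_ge0.
Qed.

End normal_expectation.

(** * Covariance of the noise entries *)

Section normal_covariance.
Context {R : realType} {n p : nat} {d : measure_display} {Omega : measurableType d}.
Variables (P : probability Omega R) (X : Omega -> 'M[R]_(n, p)) (M : 'M[R]_(n, p)).
Hypothesis hX : matrix_normal P X M.
Local Notation Z := (normal_noise X M).
Local Open Scope ereal_scope.

Let mX : measurable_fun setT X. Proof. by case: hX. Qed.

Let mXE a i : measurable_fun setT (fun w => X w a i : measurableTypeR R).
Proof. by apply: (measurable_mx_comp hX (f := fun Y => Y a i)); exact: measurable_mx_coord. Qed.

Lemma integrable_noiseM a i b j :
  P.-integrable setT (fun w => (Z a i w * Z b j w)%:E).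
Proof.
apply: (integrableM_sqr (mu := P)).
- exact: (measurable_normal_noise hX).
- exact: (measurable_normal_noise hX).
- exact: (integrable_sqr_normal_noise hX).
- exact: (integrable_sqr_normal_noise hX).
Qed.

Let prob_entry a i (A : set R) : measurable A ->
  P [set w | A (X w a i)] = normal_prob (M a i) 1 A.
Proof. by case: hX => _ XN _; exact: XN. Qed.

Lemma matrix_normal_pair a i b j (A B : set R) : (a, i) != (b, j) ->
  measurable A -> measurable B ->
  P [set w | A (X w a i) /\ B (X w b j)] =
  normal_prob (M a i) 1 A * normal_prob (M b j) 1 B.
Proof.
move=> ab mA mB; have [_ _ XI] := hX.
(* Leaving all other entries unconstrained reduces pairwise independence to joint independence. *)
pose C := fun a' i' => if (a', i') == (a, i) then A else if (a', i') == (b, j) then B else setT.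
have mC a' i' : measurable (C a' i') by rewrite /C; case: ifP => // _; case: ifP.
rewrite (_ : [set w | _] = [set w | forall a' i', C a' i' (X w a' i')]); last first.
  apply/seteqP; split=> w /=.
    move=> [Aw Bw] a' i'; rewrite /C; case: ifPn => [/eqP[-> ->]//|_].
    by case: ifPn => [/eqP[-> ->]//|].
  move=> h; split; first by have := h a i; rewrite /C eqxx.
  by have := h b j; rewrite /C eq_sym (negbTE ab) eqxx.
rewrite XI// pair_bigA/= (bigD1 (a, i))//= (bigD1 (b, j))/=; last by rewrite eq_sym.
rewrite big1 ?mule1; last first.
  move=> [a' i'] /= /andP[/negbTE h1 /negbTE h2].
  rewrite (_ : [set w | _] = setT) ?probability_setT//.
  by apply/seteqP; split=> // w _; rewrite /C h1 h2.
by rewrite /C eqxx eq_sym (negbTE ab) eqxx !prob_entry.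
Qed.

(** The joint law of the two entries is the product of their laws, and in Fubini's theorem the inner
    integral is a centred first moment. *)
Lemma integral_noiseM_neq a i b j : (a, i) != (b, j) ->
  \int[P]_w (Z a i w * Z b j w)%:E = 0.
Proof.
move=> ab.
pose phi w : measurableTypeR R * measurableTypeR R := (X w a i, X w b j).
have mphi : measurable_fun setT phi by exact: measurable_fun_pair.
pose N1 := normal_prob (M a i) 1; pose N2 := normal_prob (M b j) 1.
pose f (z : measurableTypeR R * measurableTypeR R) := ((z.1 - M a i) * (z.2 - M b j))%:E.
have mf : measurable_fun setT f.
  apply/measurable_EFinP; apply: measurable_funM; apply: measurable_funB => //.
have intP : P.-integrable setT (f \o phi) by exact: integrable_noiseM.
pose nu := measure_function_pushforward__canonical__measure_function_Measure P mphi.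
have nuE A : measurable A -> (N1 \x N2) A = nu A.
  move=> mA; apply: product_measure_unique => // A1 A2 mA1 mA2.
  exact: matrix_normal_pair.
have intf : (N1 \x N2).-integrable setT f.
  apply/integrableP; split => //.
  rewrite (@eq_measure_integral _ _ _ _ nu); last by move=> A mA _; exact: nuE.
  have /integrableP[_] := integrable_pushforward mphi mf intP measurableT.
  exact.
transitivity (\int[nu]_z f z).
  by rewrite /= integral_pushforward.
rewrite -(@eq_measure_integral _ _ _ _ nu (N1 \x N2)); last by move=> A mA _; exact: nuE.
rewrite -integral12_prod_meas1//.
apply: integral0_eq => x _; rewrite /fubini_F /f/=.
rewrite integral_normal_prob; last first.
  by apply: measurable_funM => //; exact: measurable_funB.
under eq_integral do rewrite -mulrA EFinM.
have [intN N0] := normal_pdf_first_moment (M b j).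
by rewrite integralZl// N0 mule0.
Qed.

End normal_covariance.

(** * Stein's identity with a cutoff *)

Section cutoff.
Variables (R : realType) (n p : nat).
Implicit Types (r : R) (Y : 'M[R]_(n, p)).

Definition bump_at r (x : R) : R := bump (r^-1 * x + 0).

Definition cutoff r : 'M[R]_(n, p) -> R := mx_prod (fun=> bump_at r).

Definition sqr_bump_at r (x : R) : R := bump_at r x * bump_at r x.

(* The partial derivative in the entry [c] of the squared cutoff. *)
Definition dcutoff r c : 'M[R]_(n, p) -> R :=
  mx_prod (update (fun=> sqr_bump_at r) c (derive1 (sqr_bump_at r))).

Lemma smooth_bump_at r : smooth (bump_at r).
Proof. by apply: smooth_affine; exact: smooth_bump. Qed.

Lemma smooth_sqr_bump_at r : smooth (sqr_bump_at r).
Proof. by apply: smoothM; exact: smooth_bump_at. Qed.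

Lemma cutoff_sqrE r Y : cutoff r Y ^+ 2 = mx_prod (fun=> sqr_bump_at r) Y.
Proof. by rewrite /cutoff /sqr_bump_at mx_prodM expr2. Qed.

Lemma cutoff_ge0 r Y : 0 <= cutoff r Y.
Proof. by apply: prodr_ge0 => c _; exact: bump_ge0. Qed.

Lemma cutoff_le1 r Y : cutoff r Y <= 1.
Proof. by apply: prodr_ile1 => c _; rewrite bump_ge0 bump_le1. Qed.

Lemma bump_at_eq0 r x : 0 < r -> r < `|x| -> bump_at r x = 0.
Proof.
move=> r0 rx; apply: bump_eq0; rewrite addr0 normrM gtr0_norm ?invr_gt0//.
by rewrite ler_pdivlMl// mulr1 ltW.
Qed.

Lemma cutoff_eq0 r Y : 0 < r -> ~ mx_box r Y -> cutoff r Y = 0.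
Proof.
move=> r0 /existsNP[a] /existsNP[i] /negP; rewrite -ltNge => rY.
by rewrite /cutoff (mx_prodD1 _ (a, i)) bump_at_eq0// mul0r.
Qed.

Lemma measurable_smooth (f : R -> R) : smooth f -> measurable_fun setT f.
Proof. by move=> sf; apply: continuous_measurable_fun; exact: smooth_continuous. Qed.

Lemma measurable_cutoff r : measurable_fun setT (cutoff r).
Proof.
by apply: measurable_mx_prod => c; apply: measurable_smooth; exact: smooth_bump_at.
Qed.

Lemma measurable_dcutoff r c : measurable_fun setT (dcutoff r c).
Proof.
apply: measurable_mx_prod => c'; apply: measurable_smooth; rewrite /update.
by case: ifP => _; [apply: smooth_derive1|]; exact: smooth_sqr_bump_at.
Qed.

(** The cutoff at [Y] is one fixed continuous function evaluated at [(r k)^-1 *: Y], and that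
    function equals 1 at the origin. *)
Lemma cvg_cutoff (r : nat -> R) Y : (r k)^-1 @[k --> \oo] --> (0 : R) ->
  cutoff (r k) Y @[k --> \oo] --> (1 : R).
Proof.
move=> r0; pose F : 'M[R]_(n, p) -> R := mx_prod (fun=> bump (R := R)).
have cF : continuous F.
  by apply: continuous_mx_prod => c; apply: smooth_continuous; exact: smooth_bump.
have F0 : F (0 *: Y) = 1.
  by rewrite /F /mx_prod big1// => c _; rewrite !mxE mul0r bump0.
rewrite -F0 (_ : (fun k => _) = fun k => F ((r k)^-1 *: Y)); last first.
  apply/funext => k; rewrite /cutoff /F /mx_prod; apply: eq_bigr => c _.
  by rewrite !mxE /bump_at addr0.
apply: (@cvg_comp _ _ _ (fun k => (r k)^-1 *: Y) F _ (nbhs (0 *: Y))); last exact: cF.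
exact: cvgZr_tmp.
Qed.

Lemma derive1_sqr_bump_at r x :
  derive1 (sqr_bump_at r) x = 2 * bump_at r x * (derive1 (bump (R := R)) (r^-1 * x + 0) * r^-1).
Proof.
have db : is_derive x 1 (bump_at r) (derive1 (bump (R := R)) (r^-1 * x + 0) * r^-1).
  rewrite derive1E; apply: (is_derive1_comp (f := bump (R := R))).
    by apply: derivableP; apply: smooth_derivable; exact: smooth_bump.
  by apply: is_derive_eq; rewrite addr0; exact: mulr1.
rewrite derive1E; apply: derive_val.
by apply: is_derive_eq; rewrite /GRing.scale/=; ring.
Qed.

(** In the differentiated entry, (u^2)' = 2 u u' keeps one factor u. In every other entry u^2 <= u
    since u lies in [0, 1]. The surviving factors multiply to [cutoff r Y]. *)
Lemma dcutoff_bound : exists2 C : R, 0 < C &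
  forall r c Y, 0 < r -> `|dcutoff r c Y| <= C / r * cutoff r Y.
Proof.
have [C0 hC0] := derive1_bump_bounded R.
have C00 : 0 <= C0 by apply: le_trans (hC0 0); exact: normr_ge0.
(* The summand 1 only ensures positivity, since [C0] is merely nonnegative. *)
exists (2 * C0 + 1) => [|r c Y r0]; first by lra.
rewrite /dcutoff mx_prod_update /cutoff (mx_prodD1 _ c) normrM derive1_sqr_bump_at.
set u := bump_at r _; set v := \prod_(_ | _) bump_at r _.
have u0 : 0 <= u by exact: bump_ge0.
have v0 : 0 <= v by apply: prodr_ge0 => c' _; exact: bump_ge0.
have hv : `|\prod_(c' | c' != c) sqr_bump_at r (Y c'.1 c'.2)| <= v.
  rewrite ger0_norm; last by apply: prodr_ge0 => c' _; rewrite mulr_ge0 ?bump_ge0.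
  apply: ler_prod => c' _; rewrite mulr_ge0 ?bump_ge0//=.
  by rewrite ler_piMr ?bump_ge0 ?bump_le1.
rewrite [leRHS]mulrA; apply: ler_pM => //.
have := hC0 (r^-1 * Y c.1 c.2 + 0).
clearbody u; move: (derive1 _ _) => D hD.
rewrite !normrM (ger0_norm u0) normrV ?unitfE ?gt_eqF// (gtr0_norm r0) gtr0_norm//.
rewrite (_ : 2 * u * (`|D| / r) = (2 * `|D|) * (u / r)); last by ring.
rewrite (_ : (2 * C0 + 1) / r * u = (2 * C0 + 1) * (u / r)); last by ring.
by rewrite ler_wpM2r ?divr_ge0 ?(ltW r0)//; lra.
Qed.

End cutoff.

Section local_integrability.
Context {R : realType} {n p : nat} {d : measure_display} {Omega : measurableType d}.
Variables (P : probability Omega R) (X : Omega -> 'M[R]_(n, p)) (M : 'M[R]_(n, p)).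
Hypothesis hX : matrix_normal P X M.
Local Notation mu := (@mx_lebesgue R n p).
Local Notation rho := (normal_density M).

Lemma normal_density_bounded : exists K, forall Y, `|rho Y| <= K.
Proof.
exists (\prod_(c : 'I_n * 'I_p) normal_peak 1) => Y.
rewrite ger0_norm ?normal_density_ge0//; apply: ler_prod => c _.
by rewrite normal_pdf_ge0 normal_pdf_ub ?oner_neq0.
Qed.

(** Local integrability is used on the compact box only, where [b] is bounded; off the box the
    product is 0. *)
Lemma integrable_mul_bounded (h b : 'M[R]_(n, p) -> R) (r K : R) :
  mx_locally_integrable h -> measurable_fun setT b ->
  (forall Y, mx_box r Y -> `|b Y| <= K) -> (forall Y, ~ mx_box r Y -> b Y = 0) ->
  mu.-integrable setT (fun Y => (h Y * b Y)%:E).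
Proof.
move=> [mh inth] mb bK b0; have mbox := @measurable_mx_box R n p r.
have : mu.-integrable (mx_box r) (fun Y => (h Y * b Y)%:E).
  have intKh := integrableZl mbox K (inth _ (@compact_mx_box R n p r)).
  apply: le_integrable intKh => //.
    by apply/measurable_EFinP; apply: measurable_funTS; exact: measurable_funM.
  move=> Y /bK bY; rewrite /= lee_fin !normrM mulrC.
  by rewrite ler_wpM2r// (le_trans bY)// ler_norm.
move/(integrable_mkcond _ mbox); apply: eq_integrable => // Y _.
rewrite patchE; case: ifPn => //; rewrite notin_setE => /b0 ->.
by rewrite mulr0.
Qed.

Lemma integrable_mul_bounded_comp (h b : 'M[R]_(n, p) -> R) (r K : R) :
  mx_locally_integrable h -> measurable_fun setT b ->
  (forall Y, mx_box r Y -> `|b Y| <= K) -> (forall Y, ~ mx_box r Y -> b Y = 0) ->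
  P.-integrable setT (fun w => (h (X w) * b (X w))%:E).
Proof.
move=> lh mb bK b0; have [L hL] := normal_density_bounded.
have L0 : 0 <= L by apply: le_trans (hL 0).
apply: (integrable_matrix_normal hX (f := fun Y => h Y * b Y)).
  by apply: measurable_funM => //; case: lh.
under eq_fun do rewrite -mulrA.
apply: (@integrable_mul_bounded h (fun Y => b Y * rho Y) r (K * L)) => //.
- by apply: measurable_funM => //; exact: measurable_normal_density.
- move=> Y hY; rewrite normrM; apply: ler_pM => //; exact: bK.
- by move=> Y /b0 ->; rewrite mul0r.
Qed.

End local_integrability.

Section stein_identity.
Context {R : realType} {n p : nat} {d : measure_display} {Omega : measurableType d}.
Variables (P : probability Omega R) (X : Omega -> 'M[R]_(n, p)) (M : 'M[R]_(n, p)).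
Hypothesis hX : matrix_normal P X M.
Local Notation mu := (@mx_lebesgue R n p).
Local Notation rho := (normal_density M).
Local Notation Z := (normal_noise X M).

Let test_function r : 'M[R]_(n, p) -> R :=
  mx_prod (fun c x => sqr_bump_at r x * normal_pdf (M c.1 c.2) 1 x).

Let test_functionE r Y : test_function r Y = cutoff r Y ^+ 2 * rho Y.
Proof. by rewrite cutoff_sqrE /test_function mx_prodM. Qed.

Let smooth_test r c : smooth (fun x => sqr_bump_at r x * normal_pdf (M c.1 c.2) 1 x).
Proof.
apply: smoothM; first exact: smooth_sqr_bump_at.
by move=> k; exact: derivable_upto_normal_pdf.
Qed.

Let partial_test_function r a i Y : mx_partial a i (test_function r) Y =
  dcutoff r (a, i) Y * rho Y - (Y a i - M a i) * cutoff r Y ^+ 2 * rho Y.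
Proof.
rewrite /test_function mx_partial_mx_prod; last exact: (smooth_test r (a, i)).
rewrite cutoff_sqrE /dcutoff !mx_prod_update /normal_density.
rewrite !(mx_prodD1 _ (a, i)) big_split/=.
set u := \prod_(_ | _) sqr_bump_at _ _; set v := \prod_(_ | _) normal_pdf _ _ _.
rewrite (_ : derive1 _ _ = derive1 (sqr_bump_at r) (Y a i) * normal_pdf (M a i) 1 (Y a i)
  - (Y a i - M a i) * sqr_bump_at r (Y a i) * normal_pdf (M a i) 1 (Y a i)); last first.
  have dp := is_derive_normal_pdf (M a i) (Y a i).
  have ds : is_derive (Y a i) 1 (sqr_bump_at r) (derive1 (sqr_bump_at r) (Y a i)).
    by rewrite derive1E; apply: derivableP; apply: smooth_derivable; exact: smooth_sqr_bump_at.
  rewrite [LHS]derive1E; apply: derive_val.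
  by apply: is_derive_eq; rewrite /GRing.scale/=; ring.
by ring.
Qed.

(** The weak derivative is tested against the squared cutoff times the density. Differentiating the
    density yields minus the noise times the density, and differentiating the cutoff yields the
    error term. *)
Lemma stein_cutoff (h dh : 'M[R]_(n, p) -> R) a i r : 0 < r ->
  mx_locally_integrable h -> is_weak_partial a i h dh ->
  [/\ P.-integrable setT (fun w => (h (X w) * (Z a i w * cutoff r (X w) ^+ 2))%:E),
      P.-integrable setT (fun w => (dh (X w) * cutoff r (X w) ^+ 2)%:E),
      P.-integrable setT (fun w => (h (X w) * dcutoff r (a, i) (X w))%:E) &
      \int[P]_w (h (X w) * (Z a i w * cutoff r (X w) ^+ 2)) =
      \int[P]_w (dh (X w) * cutoff r (X w) ^+ 2) +
      \int[P]_w (h (X w) * dcutoff r (a, i) (X w))].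
Proof.
move=> r0 lh [ldh wd].
have [C C0 hC] := dcutoff_bound R n p.
have mcut2 : measurable_fun setT (fun Y : 'M[R]_(n, p) => cutoff r Y ^+ 2).
  by apply: measurable_funX; exact: measurable_cutoff.
have mz : measurable_fun setT (fun Y : 'M[R]_(n, p) => Y a i - M a i).
  by apply: measurable_funB => //; exact: measurable_mx_coord.
have cut2_0 (Y : 'M[R]_(n, p)) : ~ mx_box r Y -> cutoff r Y ^+ 2 = 0.
  by move=> hY; rewrite cutoff_eq0// expr0n.
have cut2_ge0 (Y : 'M[R]_(n, p)) : 0 <= cutoff r Y ^+ 2 by exact: sqr_ge0.
have cut2_le1 (Y : 'M[R]_(n, p)) : cutoff r Y ^+ 2 <= 1.
  by rewrite exprn_ile1 ?cutoff_ge0 ?cutoff_le1.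
have mZ : measurable_fun setT (fun Y : 'M[R]_(n, p) => (Y a i - M a i) * cutoff r Y ^+ 2).
  exact: measurable_funM.
have iZ : P.-integrable setT (fun w => (h (X w) * (Z a i w * cutoff r (X w) ^+ 2))%:E).
  apply: (integrable_mul_bounded_comp hX (r := r) (K := r + `|M a i|) lh mZ).
    move=> Y hY; rewrite normrM [`|_ ^+ 2|]ger0_norm//.
    rewrite -[leRHS]mulr1 ler_pM//.
    by rewrite (le_trans (ler_normB _ _))// lerD2r.
  by move=> Y /cut2_0 ->; rewrite mulr0.
have iD : P.-integrable setT (fun w => (dh (X w) * cutoff r (X w) ^+ 2)%:E).
  apply: (integrable_mul_bounded_comp hX (r := r) (K := 1) ldh mcut2) => Y hY.
    by rewrite ger0_norm.
  exact: cut2_0.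
have iC : P.-integrable setT (fun w => (h (X w) * dcutoff r (a, i) (X w))%:E).
  apply: (integrable_mul_bounded_comp hX (r := r) (K := C / r) lh (measurable_dcutoff r (a, i))).
  - move=> Y _; apply: le_trans (hC _ _ _ r0) _.
    by rewrite ler_piMr ?cutoff_le1// divr_ge0// ltW.
  - move=> Y hY; apply/eqP; rewrite -normr_le0; apply: le_trans (hC _ _ _ r0) _.
    by rewrite cutoff_eq0// mulr0.
split => //.
have sm : mx_smooth (test_function r) by apply: mx_smooth_mx_prod; exact: smooth_test.
have cs : mx_compact_support (test_function r).
  apply: (@mx_compact_support_mx_prod _ _ _ _ r) => c x rx.
  by rewrite /sqr_bump_at bump_at_eq0// !mul0r.
have := wd _ sm cs.
have mh : measurable_fun setT h by case: lh.
have mdh : measurable_fun setT dh by case: ldh.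
rewrite (eq_integral (fun Y => ((h Y * dcutoff r (a, i) Y -
  h Y * ((Y a i - M a i) * cutoff r Y ^+ 2)) * rho Y)%:E)); last first.
  by move=> Y _; rewrite partial_test_function; congr EFin; ring.
rewrite -(integral_matrix_normal hX); last first.
  apply: measurable_funB; apply: measurable_funM => //; exact: measurable_dcutoff.
rewrite [in RHS](eq_integral (fun Y => (dh Y * cutoff r Y ^+ 2 * rho Y)%:E)); last first.
  by move=> Y _; rewrite test_functionE mulrA.
rewrite -(integral_matrix_normal hX); last exact: measurable_funM.
(* By [iZ], [iD] and [iC] all integrals are finite, so the identity may be read in the reals and the
   difference split. *)
move/(congr1 fine); rewrite fineN -/(Rintegral _ _ _) -/(Rintegral _ _ _).
rewrite RintegralB// => /eqP; rewrite subr_eq addrC -subr_eq opprK.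
by move=> /eqP <-; rewrite addrC.
Qed.

End stein_identity.

(** * Removing the cutoff *)

Section risk_identity.
Context {R : realType} {n p : nat} {d : measure_display} {Omega : measurableType d}.
Variables (P : probability Omega R) (X : Omega -> 'M[R]_(n, p)) (M : 'M[R]_(n, p)).
Hypothesis hX : matrix_normal P X M.
Variables (g : 'M[R]_(n, p) -> 'M[R]_(n, p)) (dg : 'I_n -> 'I_p -> 'M[R]_(n, p) -> 'M[R]_(n, p)).
Hypothesis hg : forall a j, weakly_differentiable (fun Y => g Y a j).
Hypothesis hdg : is_weak_derivative g dg.
Hypothesis hint : forall i j : 'I_p, P.-integrable setT (fun w =>
  ((mx_div dg (X w) + (mx_div dg (X w))^T + (g (X w))^T *m g (X w)) i j)%:E).
Local Notation int f := (P.-integrable setT (EFin \o f)).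
Local Notation Z := (normal_noise X M).
Local Notation G a j := (fun w => g (X w) a j).
Local Notation D i j := (fun w => mx_div dg (X w) i j).

(** Entry (i, j) of the matrix that the hypothesis makes integrable. *)
Let S i j w : R := D i j w + D j i w + \sum_a G a i w * G a j w.

Let intS i j : int (S i j).
Proof.
apply: eq_integrable (hint i j) => // w _.
by rewrite /S /= !mxE; congr EFin; congr (_ + _); apply: eq_bigr => a _; rewrite !mxE.
Qed.

Let mG a j : measurable_fun setT (G a j).
Proof.
apply: (measurable_mx_comp hX (f := fun Y => g Y a j)).
by have [[]] := hg a j.
Qed.

Variable C : R.
Hypothesis C_gt0 : 0 < C.
Hypothesis hC : forall r c (Y : 'M[R]_(n, p)), 0 < r -> `|dcutoff r c Y| <= C / r * cutoff r Y.

(** The factor [C] cancels the constant in the bound on [dcutoff], and [k.+1] lets the radius grow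
    and the derivative of the cutoff tend to 0. *)
Let r k : R := 8 * C * k.+1%:R.
Let r_gt0 k : 0 < r k. Proof. by rewrite !mulr_gt0. Qed.

Let W k w : R := cutoff (r k) (X w).
Let dW k a i w : R := dcutoff (r k) (a, i) (X w).

Let W0 k w : 0 <= W k w. Proof. exact: cutoff_ge0. Qed.
Let W1 k w : W k w <= 1. Proof. exact: cutoff_le1. Qed.

Let cvgW2 w : W k w ^+ 2 @[k --> \oo] --> (1 : R).
Proof.
have rV : (r k)^-1 @[k --> \oo] --> (0 : R).
  rewrite (_ : (fun k => _) = fun k => (8 * C)^-1 * harmonic k).
    by rewrite -[X in _ --> X](mulr0 (8 * C)^-1); apply: cvgM; [exact: cvg_cst|exact: cvg_harmonic].
  by apply/funext => k; rewrite /r invfM.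
have h := cvg_cutoff (X w) rV.
by have := cvgM h h; rewrite mulr1; apply.
Qed.

Let dW_le k a i w : `|dW k a i w| <= (8 * k.+1%:R)^-1 * W k w.
Proof.
apply: le_trans (hC (a, i) (X w) (r_gt0 k)) _.
rewrite ler_wpM2r ?cutoff_ge0//.
rewrite (_ : C / r k = (8 * k.+1%:R)^-1)//.
by rewrite /r; field; rewrite !gt_eqF.
Qed.

Let dW_le8 k a i w : `|dW k a i w| <= 8^-1 * W k w.
Proof.
apply: le_trans (dW_le k a i w) _; rewrite ler_wpM2r//.
by rewrite lef_pV2 ?posrE ?mulr_gt0// ler_peMr// ler1n.
Qed.

Let dW_cvg a i w : dW k a i w @[k --> \oo] --> (0 : R).
Proof.
apply/norm_cvg0P; apply: (@squeeze_cvgr _ _ _ _ (fun=> 0) (fun k => harmonic k)).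
- near=> k; rewrite normr_ge0/=; apply: le_trans (dW_le k a i w) _.
  rewrite -[leRHS]mulr1 ler_pM ?invr_ge0 ?mulr_ge0// /harmonic/=.
  by rewrite lef_pV2 ?posrE ?mulr_gt0// ler_peMl// ler1n.
- exact: cvg_cst.
- exact: cvg_harmonic.
Unshelve. all: by end_near. Qed.

Let stein k i j :
  [/\ int (fun w => \sum_a G a j w * Z a i w * W k w ^+ 2),
      int (fun w => D i j w * W k w ^+ 2),
      int (fun w => \sum_a G a j w * dW k a i w) &
      \int[P]_w (\sum_a G a j w * Z a i w * W k w ^+ 2) =
      \int[P]_w (D i j w * W k w ^+ 2) + \int[P]_w (\sum_a G a j w * dW k a i w)].
Proof.
have st a := stein_cutoff hX (r_gt0 k) (proj1 (hg a j)) (hdg a i a j).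
have int1 a : int (fun w => G a j w * Z a i w * W k w ^+ 2).
  by under eq_fun do rewrite -mulrA; have [] := st a.
have int2 a : int (fun w => dg a i (X w) a j * W k w ^+ 2) by have [] := st a.
have int3 a : int (fun w => G a j w * dW k a i w) by have [] := st a.
have DE : (fun w => D i j w * W k w ^+ 2) =
    fun w => \sum_a dg a i (X w) a j * W k w ^+ 2.
  by apply/funext => w; rewrite mxE mulr_suml.
split.
- exact: integrable_sum_EFin.
- by rewrite DE; exact: integrable_sum_EFin.
- exact: integrable_sum_EFin.
rewrite DE !Rintegral_sum// -big_split/=; apply: eq_bigr => a _.
have [_ _ _ <-] := st a.
by apply: eq_Rintegral => w _; rewrite mulrA.
Qed.

Let intZZ a i b j : int (fun w => Z a i w * Z b j w).
Proof. exact: (integrable_noiseM hX). Qed.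

Let intZ2 a i : int (fun w => Z a i w ^+ 2).
Proof. exact: (integrable_sqr_normal_noise hX). Qed.

Let mW k : measurable_fun setT (W k).
Proof. by apply: (measurable_mx_comp hX); exact: measurable_cutoff. Qed.

Let mW2 k : measurable_fun setT (fun w => W k w ^+ 2).
Proof. exact: measurable_funX. Qed.

Let W2_ge0 k w : 0 <= W k w ^+ 2. Proof. exact: sqr_ge0. Qed.
Let W2_le1 k w : W k w ^+ 2 <= 1. Proof. by rewrite exprn_ile1. Qed.

Let int_mulW2 k (f : Omega -> R) : int f -> int (fun w => f w * W k w ^+ 2).
Proof.
move=> hf; apply: le_integrable_EFin (integrable_norm hf).
  by apply: measurable_funM => //; exact: integrable_measurable hf.
by move=> w; rewrite normrM ler_piMr// ger0_norm.
Qed.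

Let Q j w : R := \sum_a G a j w ^+ 2.

(** Local integrability of [g] says nothing about its square. On the diagonal, however, Q = S - 2 D,
    where [S] is integrable and [D] is integrable once cut off. *)
Let intQW k j : int (fun w => Q j w * W k w ^+ 2).
Proof.
have [_ hD _ _] := stein k j j.
have := integrableB_EFin (int_mulW2 k (intS j j)) (integrableZl_EFin 2 hD).
apply: eq_integrable => // w _; congr EFin; rewrite /S /Q.
by under eq_bigr do rewrite -expr2; ring.
Qed.

Let normS j : R := \int[P]_w `|S j j w|.

(* The cross terms [2 G Z] and [2 G dW] are absorbed into [Q W^2]: the factor [8] in [r] makes
   the total absorbed fraction [5/8 < 1], whence a bound uniform in [k]. *)
Let QW_bound k j : \int[P]_w (Q j w * W k w ^+ 2) <= 3 * (normS j + 3 * n%:R).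
Proof.
have [hT hD hE eq] := stein k j j.
have hS := intS j j.
have hSW := int_mulW2 k hS.
have hSn : int (fun w => `|S j j w|) by exact: integrable_norm.
have hZ : int (fun w => \sum_a Z a j w ^+ 2) by exact: integrable_sum_EFin.
have hQW := intQW k j.
set T1 := fun w => \sum_a G a j w * Z a j w * W k w ^+ 2 in hT eq.
set E1 := fun w => \sum_a G a j w * dW k a j w in hE eq.
have IZ : \int[P]_w (\sum_a Z a j w ^+ 2) = n%:R.
  rewrite Rintegral_sum// (eq_bigr (fun=> 1)) ?sumr_const ?card_ord// => a _.
  by rewrite /Rintegral (integral_sqr_normal_noise hX).
have IQ : \int[P]_w (Q j w * W k w ^+ 2) =
    \int[P]_w (S j j w * W k w ^+ 2 - 2 * (T1 w - E1 w)).
  rewrite (@eq_Rintegral _ _ _ P _ (fun w => S j j w * W k w ^+ 2 - 2 * (D j j w * W k w ^+ 2))); last first.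
    by move=> w _; rewrite /S /Q; under [in RHS]eq_bigr do rewrite -expr2; ring.
  have hTE := integrableB_EFin hT hE.
  rewrite !RintegralB//; try exact: integrableZl_EFin.
  by rewrite !RintegralZl// RintegralB// eq addrK.
have ptw w : S j j w * W k w ^+ 2 - 2 * (T1 w - E1 w) <=
    `|S j j w| + (5 / 8 * (Q j w * W k w ^+ 2) + (2 * (\sum_a Z a j w ^+ 2) + 8^-1 * n%:R)).
  have hs : S j j w * W k w ^+ 2 <= `|S j j w|.
    apply: le_trans (ler_norm _) _; rewrite normrM ler_piMr//.
    by rewrite ger0_norm.
  have hn : n%:R = \sum_(a < n) 1 :> R by rewrite sumr_const card_ord.
  suff : - 2 * T1 w + 2 * E1 w <=
      5 / 8 * (Q j w * W k w ^+ 2) + (2 * (\sum_a Z a j w ^+ 2) + 8^-1 * n%:R) by lra.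
  rewrite hn /T1 /E1 /Q mulr_suml !mulr_sumr -!big_split/=; apply: ler_sum => a _.
  have := dW_le8 k a j w; have := W0 k w; have := W1 k w.
  move: (W k w) (dW k a j w) (g (X w) a j) (Z a j w) => u v x z u1 u0.
  rewrite ler_norml => /andP[v1 v2].
  (* Completing the square in x u and z u; u <= 1 leaves room for the full z^2. This costs the
     fraction 1/2 of the quadratic term, and [e2] costs 1/8. *)
  have e1 : - 2 * (x * z * u ^+ 2) <= 2^-1 * (x ^+ 2 * u ^+ 2) + 2 * z ^+ 2.
    have : 0 <= 2^-1 * (x * u + 2 * z * u) ^+ 2 + 2 * (z ^+ 2 * (1 - u ^+ 2)).
      have : 0 <= 1 - u ^+ 2 by rewrite subr_ge0 exprn_ile1.
      move=> h; apply: addr_ge0; first by apply: mulr_ge0 => //; exact: sqr_ge0.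
      by apply: mulr_ge0 => //; apply: mulr_ge0 => //; exact: sqr_ge0.
    by lra.
  have e2 : 2 * (x * v) <= 8^-1 * (x ^+ 2 * u ^+ 2) + 8^-1.
    have [x0|x0] := leP 0 x.
      have : x * v <= x * (8^-1 * u) by rewrite ler_wpM2l.
      by have := sqr_ge0 (x * u - 1); lra.
    have : x * v <= x * (- (8^-1 * u)) by rewrite ler_wnM2l// ltW.
    by have := sqr_ge0 (x * u + 1); lra.
  by lra.
have hR : int (fun w => `|S j j w| +
    (5 / 8 * (Q j w * W k w ^+ 2) + (2 * (\sum_a Z a j w ^+ 2) + 8^-1 * n%:R))).
  do 3 (apply: integrableD_EFin; first by [|exact: integrableZl_EFin]).
  exact: finite_measure_integrable_cst.
have hL : int (fun w => S j j w * W k w ^+ 2 - 2 * (T1 w - E1 w)).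
  apply: integrableB_EFin; first by [].
  by apply: integrableZl_EFin; exact: integrableB_EFin.
have := le_Rintegral measurableT hL hR (fun w _ => ptw w).
have hc : int (fun w : Omega => 8^-1 * n%:R : R) by exact: finite_measure_integrable_cst.
have h2Z := integrableZl_EFin 2 hZ.
have h5Q := integrableZl_EFin (5 / 8) hQW.
have e1 := RintegralZl (5 / 8) measurableT hQW.
have e2 : \int[P]_w (2 * (\sum_a Z a j w ^+ 2)) = 2 * n%:R.
  by rewrite (RintegralZl 2 measurableT hZ) IZ.
have e3 : \int[P]_w (8^-1 * n%:R) = 8^-1 * n%:R :> R.
  by rewrite Rintegral_cst// [fine _](congr1 fine (@probability_setT _ _ _ P)) mulr1.
rewrite -IQ RintegralD//; last exact/integrableD_EFin/integrableD_EFin.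
rewrite RintegralD//; last exact: integrableD_EFin.
rewrite RintegralD// e1 e2 e3 -/(normS j).
(* With I the integral to be bounded, I minus 5/8 I leaves 3/8 I <= normS + (17/8) n, that is I <=
   (8/3) normS + (17/3) n, which is rounded up. *)
have : 0 <= normS j by apply: Rintegral_ge0.
have : 0 <= n%:R :> R by [].
by lra.
Qed.

Let mQ j : measurable_fun setT (Q j).
Proof. by apply: measurable_sum => a; exact: measurable_funX. Qed.

Let intQ j : int (Q j).
Proof.
apply: (@integrable_of_bounded_integrals _ _ _ P _ (fun k w => Q j w * W k w ^+ 2)).
- by move=> k w; rewrite mulr_ge0// sumr_ge0// => a _; exact: sqr_ge0.
- by move=> k; exact: intQW.
- by move=> k; exact: QW_bound.
- move=> w; have := cvgM (@cvg_cst _ (Q j w) _ \oo _) (cvgW2 w).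
  by rewrite mulr1; apply.
Qed.

Let intG2 a j : int (fun w => G a j w ^+ 2).
Proof.
apply: le_integrable_EFin (intQ j); first exact: measurable_funX.
move=> w; rewrite ger0_norm ?sqr_ge0// /Q (bigD1 a)//= lerDl.
by apply: sumr_ge0 => b _; exact: sqr_ge0.
Qed.

Let intGZ a j b i : int (fun w => G a j w * Z b i w).
Proof. by apply: integrableM_sqr => //; exact: (measurable_normal_noise hX). Qed.

Let intGG a j b i : int (fun w => G a j w * G b i w).
Proof. exact: integrableM_sqr. Qed.

Let intnG a j : int (fun w => `|G a j w|).
Proof.
have h := integrableD_EFin (intG2 a j) (finite_measure_integrable_cst P (1 : R) measurableT).
apply: le_integrable_EFin h; first exact: measurableT_comp.
move=> w; rewrite normr_id /= -[_ ^+ 2]real_normK ?num_real//.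
by have := normr_ge0 (g (X w) a j); nra.
Qed.

Let U i j w : R := \sum_a G a j w * Z a i w.

Let intU i j : int (U i j). Proof. exact: integrable_sum_EFin. Qed.

(** The defect in the symmetrised Stein identity. Only the sum of the two divergences is known to be
    integrable, as [S] minus the products of entries of g. *)
Let V i j w : R := U i j w + U j i w - (D i j w + D j i w).

Let intV i j : int (V i j).
Proof.
apply: integrableB_EFin; first exact: integrableD_EFin.
have hGG : int (fun w => \sum_a G a i w * G a j w) by exact: integrable_sum_EFin.
have := integrableB_EFin (intS i j) hGG.
by apply: eq_integrable => // w _; congr EFin; rewrite /S addrK.
Qed.

Let E k i j w : R := \sum_a G a j w * dW k a i w.

Let E_le k i j w : `|E k i j w| <= \sum_a `|G a j w|.
Proof.
apply: le_trans (ler_norm_sum _ _ _) _; apply: ler_sum => a _.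
rewrite normrM ler_piMr//; apply: le_trans (dW_le8 k a i w) _.
by have := W1 k w; lra.
Qed.

Let E_cvg i j w : E k i j w @[k --> \oo] --> (0 : R).
Proof.
rewrite /E; elim: (index_enum _) => [|a s IH].
  by under eq_fun do rewrite big_nil; exact: cvg_cst.
under eq_fun do rewrite big_cons.
have := cvgD (cvgM (@cvg_cst _ (G a j w) _ \oo _) (dW_cvg a i w)) IH.
by rewrite mulr0 addr0; apply.
Qed.

(** Each [half] has mean zero by Stein's identity with cutoff. A majorant free of [k] is at hand for
    the sum of the two halves, where [V] appears, so the limit is taken there. *)
Let integralV i j : (\int[P]_w (V i j w)%:E = 0)%E.
Proof.
pose f k w := V i j w * W k w ^+ 2 - (E k i j w + E k j i w).
pose half k i j w : R := \sum_a G a j w * Z a i w * W k w ^+ 2 -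
  (D i j w * W k w ^+ 2 + E k i j w).
have int_half k i' j' : int (half k i' j').
  have [h1 h2 h3 _] := stein k i' j'.
  by apply: integrableB_EFin => //; exact: integrableD_EFin.
have half0 k i' j' : \int[P]_w (half k i' j' w) = 0.
  have [h1 h2 h3 h4] := stein k i' j'.
  rewrite RintegralB//; last exact: integrableD_EFin.
  by rewrite h4 RintegralD// subrr.
have fE k : f k = fun w => half k i j w + half k j i w.
  by apply/funext => w; rewrite /f /half /V /U -!mulr_suml; ring.
apply: (@integral_cvg_zero _ _ _ P _
  (fun w => `|V i j w| + (\sum_a `|G a j w| + \sum_a `|G a i w|)) f).
- by move=> k; rewrite fE; exact: integrableD_EFin.
- by move=> k; rewrite fE RintegralD// !half0 addr0.
- apply: integrableD_EFin; first exact: integrable_norm.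
  by apply: integrableD_EFin; exact: integrable_sum_EFin.
- move=> k w; apply: le_trans (ler_normB _ _) _; apply: lerD.
    by rewrite normrM ler_piMr// ger0_norm.
  by apply: le_trans (ler_normD _ _) _; apply: lerD; exact: E_le.
- move=> w; have := cvgB (cvgM (@cvg_cst _ (V i j w) _ \oo _) (cvgW2 w)) (cvgD (E_cvg i j w) (E_cvg j i w)).
  by rewrite mulr1 addr0 subr0; apply.
Qed.

Let integralZZ i j : (\int[P]_w (\sum_a Z a i w * Z a j w)%:E = (n%:R * (i == j)%:R)%:E)%E.
Proof.
under eq_integral do rewrite -sumEFin.
rewrite integral_sum//; last by move=> a; exact: intZZ.
transitivity (\sum_(a < n) ((i == j)%:R : R)%:E)%E; last first.
  by rewrite sumEFin sumr_const card_ord mulr_natl.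
apply: eq_bigr => a _; case: eqVneq => [->|ij].
  by under eq_integral do rewrite -expr2; exact: integral_sqr_normal_noise.
by apply: (integral_noiseM_neq hX); apply: contra ij => /eqP[->].
Qed.

(** The expanded product is the noise covariance term plus [S i j] plus the defect [V i j], and the
    defect has mean zero. *)
Lemma integral_shrinkage_loss i j :
  (\int[P]_w (\sum_a (Z a i w + G a i w) * (Z a j w + G a j w))%:E =
   (n%:R * (i == j)%:R)%:E + \int[P]_w (S i j w)%:E)%E.
Proof.
have intZZs : int (fun w => \sum_a Z a i w * Z a j w) by exact: integrable_sum_EFin.
rewrite -[X in (X + _)%E]adde0 -(integralV i j) -integralZZ.
rewrite -integralD_EFin// -integralD_EFin//; last exact: integrableD_EFin.
apply: eq_integral => w _ /=; congr EFin.
have -> : \sum_a (Z a i w + G a i w) * (Z a j w + G a j w) =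
    \sum_a Z a i w * Z a j w + (U i j w + U j i w + \sum_a G a i w * G a j w).
  by rewrite /U -!big_split/=; apply: eq_bigr => a _; ring.
by rewrite /V /S; ring.
Qed.

End risk_identity.

Unset Implicit Arguments.
Set Strict Implicit.
Set Printing Implicit Defensive.

Theorem theorem2p4 (R : realType) (n p : nat) (hn : (1 <= n)%N) (hp : (1 <= p)%N)
    (hnp : (p + 1 < n)%N)
    (M : 'M[R]_(n, p))
    (d : measure_display) (Omega : measurableType d) (P : probability Omega R)
    (X : Omega -> 'M[R]_(n, p)) (hX : matrix_normal P X M)
    (g : 'M[R]_(n, p) -> 'M[R]_(n, p))
    (hg : forall a j, weakly_differentiable (fun Y => g Y a j))
    (dg : 'I_n -> 'I_p -> 'M[R]_(n, p) -> 'M[R]_(n, p))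
    (hdg : is_weak_derivative g dg)
    (hint : forall i j : 'I_p, P.-integrable setT (fun w =>
       ((mx_div dg (X w) + (mx_div dg (X w))^T + (g (X w))^T *m g (X w)) i j)%:E)) :
  quadratic_risk P X M (fun Y => Y + g Y) =
  map_mx EFin (n%:R *: 1%:M) +
  mx_expectation P (fun w =>
    mx_div dg (X w) + (mx_div dg (X w))^T + (g (X w))^T *m g (X w)).
Proof.
have [C C_gt0 hC] := dcutoff_bound R n p.
apply/matrixP => i j; rewrite !mxE unlock.
transitivity (\int[P]_w (\sum_a (normal_noise X M a i w + g (X w) a i) *
    (normal_noise X M a j w + g (X w) a j))%:E)%E.
  apply: eq_integral => w _; congr EFin; rewrite !mxE; apply: eq_bigr => a _.
  by rewrite !mxE /normal_noise addrAC [X in _ * X]addrAC.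
rewrite (integral_shrinkage_loss hX hg hdg hint C_gt0 hC).
congr (_ + _)%E; apply: eq_integral => w _; congr EFin.
by rewrite !mxE; congr (_ + _); apply: eq_bigr => a _; rewrite !mxE.
Qed.
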